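(* Let $\mathcal{A}$ be a set of objects, each with a size $|A|\in\mathbb{N}$, let $B$ be a positive integer, let $\Phi,\Phi_2$ be finite sets, and let $f\colon\mathcal{A}\to\Phi$ be a function such that $|A|$ is determined by $f(A)$. Suppose there is a map $\mathrm{Decompose}$ assigning to each $A\in\mathcal{A}$ a tuple $\mathrm{Decompose}(A)=(\beta,A_1,\ldots,A_B)\in\Phi_2\times\mathcal{A}^B$; write $g(A)=\beta$, $f_i(A)=f(A_i)$, and $\mathcal{F}=\{(g(A),f_1(A),\ldots,f_B(A)) : A\in\mathcal{A}\}$. Assume (P1) there is $\mathrm{Join}\colon\Phi_2\times\mathcal{A}^B\to\mathcal{A}$ with $\mathrm{Join}(\mathrm{Decompose}(A))=A$ for all $A$; (P2) $\mathrm{Decompose}(\mathrm{Join}(\beta,A_1,\ldots,A_B))=(\beta,A_1,\ldots,A_B)$ whenever $(\beta,f(A_1),\ldots,f(A_B))\in\mathcal{F}$; (P3) there is $f'\colon\mathcal{F}\to\Phi$ with $f(A)=f'(g(A),f_1(A),\ldots,f_B(A))$ for all $A$; (P4) there is a constant $\delta\le B/2$ with $|A_i|\le\delta|A|/B$ for all $i$ whenever $\mathrm{Decompose}(A)=(\beta,A_1,\ldots,A_B)$. Let $N(\alpha,\beta)$ be the number of $A\in\mathcal{A}$ with $f(A)=\alpha$ and $g(A)=\beta$. If $B=O(w/\log(|\Phi|+|\Phi_2|))$, where $w$ is the word size of the word RAM, then the generalized aB-tree of an object $A\in\mathcal{A}$ can be stored using at most $\log N(f(A),g(A))+2$ bits,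 and a query can be performed in $O(\log_B|A|)$ time using precomputed tables of size $O(a_1+|\Phi|^B\cdot|\Phi_2|^B\cdot(|\Phi|\cdot|\Phi_2|+B))$, where $a_1$ is the number of objects in $\mathcal{A}$ of size $1$.
   Context: The generalized aB-tree of $A$ is the rooted tree whose root stores $f(A)$ and $g(A)$ and whose children are the roots of the generalized aB-trees of $A_1,\ldots,A_B$ where $\mathrm{Decompose}(A)=(\beta,A_1,\ldots,A_B)$; the recursion stops at objects of size $0$ or $1$. The values $f(A)$, $g(A)$ at the root are assumed to be available and are not counted in the space bound. A query is an algorithm that descends the generalized aB-tree from the root; at each node it chooses which child to descend to by examining the values stored at the children of that node, under the assumption that when these values are packed into one word the choice is made in constant time; on reaching a leaf it returns the answer.
   Formalization: Memory is assumed addressable by the word RAM: a_1 ≤ 2^w and log N(α,β) ≤ 2^w for all α, β (otherwise the claim fails); words have O(w) bits; the time bound reads O(1+log_B|A|) and is claimed only for B > 1, since log_1 is undefined. *)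

(* Defs.v *)
From HB Require Import structures.
From mathcomp Require Import all_boot all_order all_algebra.
From mathcomp Require Import reals exp.

Set Implicit Arguments.
Unset Strict Implicit.
Unset Printing Implicit Defensive.

Import Order.TTheory GRing.Theory Num.Theory.

Definition log2 (R : realType) (x : R) : R := (ln x / ln 2)%R.

Definition gval (A Phi2 : finType) (B : nat)
  (decompose : A -> Phi2 * B.-tuple A) (X : A) : Phi2 := (decompose X).1.

Definition part (A Phi2 : finType) (B : nat)
  (decompose : A -> Phi2 * B.-tuple A) (X : A) (i : 'I_B) : A :=
  tnth (decompose X).2 i.

(* (g(X), f_1(X), ..., f_B(X)) *)
Definition profile (A Phi Phi2 : finType) (B : nat) (f : A -> Phi)
  (decompose : A -> Phi2 * B.-tuple A) (X : A) : Phi2 * B.-tuple Phi :=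
  (gval decompose X, [tuple f (part decompose X i) | i < B]).

Definition calF (A Phi Phi2 : finType) (B : nat) (f : A -> Phi)
  (decompose : A -> Phi2 * B.-tuple A) (p : Phi2 * B.-tuple Phi) : Prop :=
  exists X : A, p = profile f decompose X.

Definition numN (A Phi Phi2 : finType) (B : nat) (f : A -> Phi)
  (decompose : A -> Phi2 * B.-tuple A) (al : Phi) (be : Phi2) : nat :=
  #|[set X : A | (f X == al) && (gval decompose X == be)]|.

Definition size1 (A : finType) (sz : A -> nat) : {set A} :=
  [set X : A | sz X == 1].

(* The third component of a leaf is the object itself when it has size 1, and
   [None] when it has size 0. *)
Definition leafval (A Phi Phi2 : finType) : Type := (Phi * Phi2 * option A)%type.

Inductive abtree (A Phi Phi2 : finType) (B : nat) : Type :=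
| Leaf of leafval A Phi Phi2
| Node of Phi * Phi2 & {ffun 'I_B -> abtree A Phi Phi2 B}.

Arguments Leaf {A Phi Phi2 B}.
Arguments Node {A Phi Phi2 B}.

Definition root_label (A Phi Phi2 : finType) (B : nat)
  (t : abtree A Phi Phi2 B) : Phi * Phi2 :=
  match t with Leaf l => l.1 | Node v _ => v end.

(* The parts of an object of size at least 2 are strictly smaller than it (they
   have at most half its size), so [sz X] is enough fuel in [abtree_of]. *)
Fixpoint abtree_fuel (A Phi Phi2 : finType) (B : nat) (sz : A -> nat)
  (f : A -> Phi) (decompose : A -> Phi2 * B.-tuple A) (fuel : nat) (X : A) :
  abtree A Phi Phi2 B :=
  let v := (f X, gval decompose X) in
  let leaf := Leaf (v, if sz X == 1 then Some X else None) in
  if sz X <= 1 then leaf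
  else if fuel is k.+1 then
    Node v [ffun i => abtree_fuel sz f decompose k (part decompose X i)]
  else leaf.

Definition abtree_of (A Phi Phi2 : finType) (B : nat) (sz : A -> nat)
  (f : A -> Phi) (decompose : A -> Phi2 * B.-tuple A) (X : A) :
  abtree A Phi Phi2 B :=
  abtree_fuel sz f decompose (sz X) X.

(* [S] is the type of internal states of the query algorithm: from its current
   state and the values at the children it picks a child and moves to a new
   state. *)
Record query (A Phi Phi2 : finType) (B : nat) (S Ans : Type) := Query {
  choose : S -> B.-tuple (Phi * Phi2) -> 'I_B * S;
  answer : S -> leafval A Phi Phi2 -> Ans
}.

Fixpoint query_abtree (A Phi Phi2 : finType) (B : nat) (S Ans : Type)
  (q : query A Phi Phi2 B S Ans) (t : abtree A Phi Phi2 B) (s : S) : Ans :=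
  match t with
  | Leaf l => answer q s l
  | Node _ ch =>
      let r := choose q s [tuple root_label (ch i) | i < B] in
      query_abtree q (ch r.1) r.2
  end.

Inductive binop :=
  Add | Sub | Mul | Div | Mod | Shl | Shr | And | Or | Xor | Lt | Eq.

(* [W] is the number of bits of a word; arithmetic is modulo [2 ^ W]. *)
Definition eval_binop (W : nat) (o : binop) (x y : nat) : nat :=
  match o with
  | Add => (x + y) %% 2 ^ W
  | Sub => (2 ^ W + x - y) %% 2 ^ W
  | Mul => (x * y) %% 2 ^ W
  | Div => x %/ y
  | Mod => x %% y
  | Shl => (x * 2 ^ y) %% 2 ^ W
  | Shr => x %/ 2 ^ y
  | And => Nat.land x y
  | Or => Nat.lor x y
  | Xor => Nat.lxor x y
  | Lt => x < y
  | Eq => x == y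
  end.

(* Register names are numerals in the program text, so a program uses a
   constant number of registers; the memory is read-only. *)
Inductive cmd :=
| Const (d n : nat)
| Op (o : binop) (d a b : nat)
| LoadTable (d a : nat)
| LoadData (d a : nat)
| Choose (d a : nat)
| Seq (c1 c2 : cmd)
| If (a : nat) (c1 c2 : cmd)
| While (a : nat) (c : cmd).

Definition regs := nat -> nat.

Definition upd (r : regs) (d v : nat) : regs :=
  fun k => if k == d then v else r k.

(* The [j]-th word of a bit string packed [W] bits to the word, padded with
   zeros. *)
Definition data_word (W : nat) (D : bitseq) (j : nat) : nat :=
  \sum_(i < W) nth false D (j * W + i) * 2 ^ i.

(* [exec W T D ask c r s t r' s']: with tables [T] and data [D], the program [c]
   started in registers [r] and query state [s] halts in [r'] and [s'] after
   exactly [t] steps.  [ask s x i s'] holds if the query algorithm in state [s],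
   handed the word [x], replies [i] and moves to state [s']; a [Choose] is one
   step. *)
Inductive exec (W : nat) (T : seq nat) (D : bitseq) (S : Type)
  (ask : S -> nat -> nat -> S -> Prop) :
  cmd -> regs -> S -> nat -> regs -> S -> Prop :=
| ExConst d n r s :
    exec W T D ask (Const d n) r s 1 (upd r d (n %% 2 ^ W)) s
| ExOp o d a b r s :
    exec W T D ask (Op o d a b) r s 1
      (upd r d (eval_binop W o (r a) (r b))) s
| ExLoadTable d a r s :
    exec W T D ask (LoadTable d a) r s 1 (upd r d (nth 0 T (r a))) s
| ExLoadData d a r s :
    exec W T D ask (LoadData d a) r s 1 (upd r d (data_word W D (r a))) s
| ExChoose d a r s i s' :
    ask s (r a) i s' ->
    exec W T D ask (Choose d a) r s 1 (upd r d i) s'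
| ExSeq c1 c2 r s t1 r1 s1 t2 r2 s2 :
    exec W T D ask c1 r s t1 r1 s1 ->
    exec W T D ask c2 r1 s1 t2 r2 s2 ->
    exec W T D ask (Seq c1 c2) r s (t1 + t2) r2 s2
| ExIfTrue a c1 c2 r s t r1 s1 :
    r a != 0 ->
    exec W T D ask c1 r s t r1 s1 ->
    exec W T D ask (If a c1 c2) r s t.+1 r1 s1
| ExIfFalse a c1 c2 r s t r1 s1 :
    r a = 0 ->
    exec W T D ask c2 r s t r1 s1 ->
    exec W T D ask (If a c1 c2) r s t.+1 r1 s1
| ExWhileStop a c r s :
    r a = 0 ->
    exec W T D ask (While a c) r s 1 r s
| ExWhileLoop a c r s t1 r1 s1 t2 r2 s2 :
    r a != 0 ->
    exec W T D ask c r s t1 r1 s1 ->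
    exec W T D ask (While a c) r1 s1 t2 r2 s2 ->
    exec W T D ask (While a c) r s (t1 + t2).+1 r2 s2.

Definition label_code (Phi Phi2 : finType) (v : Phi * Phi2) : nat :=
  enum_rank v.1 * #|Phi2| + enum_rank v.2.

(* The values at the [B] children, packed as the digits of a single number. *)
Definition pack (Phi Phi2 : finType) (B : nat) (v : B.-tuple (Phi * Phi2)) :
  nat :=
  \sum_(i < B) label_code (tnth v i) * (#|Phi| * #|Phi2|) ^ i.

Definition ask_query (A Phi Phi2 : finType) (B : nat) (S Ans : Type)
  (q : query A Phi Phi2 B S Ans) (s : S) (x i : nat) (s' : S) : Prop :=
  exists v : B.-tuple (Phi * Phi2),
    [/\ x = pack v, i = (choose q s v).1 & s' = (choose q s v).2].

(* The values at the root are handed over in registers 0 and 1. *)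
Definition init_regs (Phi Phi2 : finType) (al : Phi) (be : Phi2) : regs :=
  upd (upd (fun=> 0) 0 (enum_rank al)) 1 (enum_rank be).

(* A leaf is reported by its values, in register 0, and the number of its object
   in the list of objects of size 1, in register 1 (0 means size 0). *)
Definition reports_leaf (A Phi Phi2 : finType) (sz : A -> nat) (r : regs)
  (l : leafval A Phi Phi2) : Prop :=
  r 0 = label_code l.1 /\
  r 1 = (if l.2 is Some X then (index X (enum (size1 sz))).+1 else 0).

Definition returns (A Phi Phi2 : finType) (B : nat) (sz : A -> nat)
  (S Ans : Type) (q : query A Phi Phi2 B S Ans) (W : nat) (T : seq nat)
  (D : bitseq) (P : cmd) (al : Phi) (be : Phi2) (s0 : S) (t : nat) (a : Ans) :
  Prop :=
  exists (r : regs) (s : S) (l : leafval A Phi Phi2),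
    [/\ exec W T D (ask_query q) P (init_regs al be) s0 t r s,
        reports_leaf sz r l & a = answer q s l].

(* Main.v *)
(** Every label [(f X, g X)] is given a number [M] of memory bits and a spill
    universe [K]: an object with this label is stored as [M] bits together with
    an integer below [K], and [K 2^M] exceeds the number [N] of such objects only
    by a factor [(1 + 2^-t)^lambda], with [lambda] at most [3 rk (log N)] where
    [rk] counts the smaller sizes.  Since a node whose label has a single object
    costs nothing and [log N <= 2^w], taking [t = O(w)] keeps the total loss
    below one bit, and rounding the root's spill to whole bits loses another.

    At an inner node two losses of relative size [2^-t] occur.  The spills of the
    [B] children do not fit into one word, so they are merged as in Dodis,
    Patrascu and Thorup's "Changing base without losing space": consecutive
    spills are multiplied until a group is large, the low part of the group is
    written to memory together with the carry left by the previous group, and its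
    high part becomes the next carry; any spill is then recovered from two words.
    The alternatives for the tuple of children's labels share the spill universe
    of the node in proportion to their sizes; an alias table with at most twice
    as many cells as there are tuples, each cell holding at most two of them,
    finds the tuple from the spill in constant time. *)

Require Import Defs.
From HB Require Import structures.
From Stdlib Require PeanoNat.
From mathcomp Require Import all_boot all_order all_algebra.
From mathcomp Require Import zify ring lra.
From mathcomp Require Import boolp reals exp.

Set Implicit Arguments.
Unset Strict Implicit.
Unset Printing Implicit Defensive.

(** * Reading bits of a number *)

(** The tables know labels but no objects, so one layout has to serve all objects with the same
    label. (P2) and (P3) make this affordable: parts may be exchanged for others with the same
    labels, so an alternative accounts for at least as many objects as the product of the counts of
    its parts.

    The number of levels cannot be bounded through sizes, which may be arbitrarily large compared
    with [w]. But the size is a function of [f], so at most [#|Phi|] sizes occur, and the rank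
    counts levels by them.

    The invariant behind all estimates is that a label with memory has a spill universe of at least
    [E2 = 2^(2t)]. The number of tuples of labels is at most [2^t = E], so rounding every share up
    by one unit is a relative error of at most [1/E]. Universes are kept below [4 E2] and groups are
    closed at [4 E E2]; then the numbers that the program looks up are at most [2^(8t)], and words
    of [20 t] bits hold products of two of them. *)

Definition readbits (D a P : nat) : nat := (D %/ 2 ^ a) %% P.

Lemma modn_pow2 n L k : L <= k -> (n %% 2 ^ k) %% 2 ^ L = n %% 2 ^ L.
Proof. by move=> le; rewrite modn_dvdm // dvdn_exp2l. Qed.

Lemma divn_modpow n M o : o <= M ->
  (n %% 2 ^ M) %/ 2 ^ o = (n %/ 2 ^ o) %% 2 ^ (M - o).
Proof.
move=> le; have eM : 2 ^ M = 2 ^ (M - o) * 2 ^ o by rewrite -expnD subnK.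
rewrite [in RHS](divn_eq n (2 ^ M)) {3}eM mulnA.
rewrite divnMDl ?expn_gt0 // modnMDl [RHS]modn_small //.
by rewrite ltn_divLR ?expn_gt0 // -eM ltn_pmod // expn_gt0.
Qed.

Lemma readbits_sub D a M m o L : readbits D a (2 ^ M) = m -> o + L <= M ->
  readbits D (a + o) (2 ^ L) = readbits m o (2 ^ L).
Proof.
rewrite /readbits => <- le.
rewrite divn_modpow; last by lia.
rewrite modn_pow2; last by lia.
by rewrite expnD divnMA.
Qed.

Lemma readbits_low m1 m2 L1 L2 : m1 < 2 ^ L1 ->
  L2 = L1 -> readbits (m1 + 2 ^ L1 * m2) 0 (2 ^ L2) = m1.
Proof.
by move=> lt ->; rewrite /readbits divn1 mulnC addnC modnMDl modn_small.
Qed.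

Lemma readbits_high m1 m2 L1 L2 : m1 < 2 ^ L1 -> m2 < 2 ^ L2 ->
  readbits (m1 + 2 ^ L1 * m2) L1 (2 ^ L2) = m2.
Proof.
move=> lt1 lt2; rewrite /readbits mulnC addnC divnMDl ?expn_gt0 //.
by rewrite divn_small // addn0 modn_small.
Qed.

Lemma readbits_mid m1 m2 L1 L2 P : m1 < 2 ^ L1 -> 
  readbits (m1 + 2 ^ L1 * m2) (L1 + L2) P = readbits m2 L2 P.
Proof.
move=> lt1; rewrite /readbits expnD divnMA mulnC addnC divnMDl ?expn_gt0 //.
by rewrite [m1 %/ _]divn_small // addn0.
Qed.

Lemma cat_lt m1 m2 L1 L2 : m1 < 2 ^ L1 -> m2 < 2 ^ L2 ->
  m1 + 2 ^ L1 * m2 < 2 ^ (L1 + L2).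
Proof. rewrite expnD => l1 l2; nia. Qed.

(** * Products of small relative errors *)

Section Slack.
Context (E : nat).

(** This is [a <= b * (1 + 1/E)^n] with denominators cleared, so that losses are multiplied and
    chained without leaving [nat]. *)
Definition slack_le (n a b : nat) : bool := a * E ^ n <= b * E.+1 ^ n.

Lemma slack_le0 a b : a <= b -> slack_le 0 a b.
Proof. by rewrite /slack_le !expn0 !muln1. Qed.

Lemma slack_le_weak n n' a b : n <= n' -> slack_le n a b -> slack_le n' a b.
Proof.
rewrite /slack_le => le h; rewrite -(subnK le) addnC !expnD !mulnA.
by apply: leq_mul => //; case: (n' - n) => [|k] //; rewrite leq_exp2r.
Qed.

Lemma slack_le_mul n1 n2 a b c d :
  slack_le n1 a b -> slack_le n2 c d -> slack_le (n1 + n2) (a * c) (b * d).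
Proof.
rewrite /slack_le => h1 h2.
by rewrite !expnD mulnACA [X in _ <= X]mulnACA leq_mul.
Qed.

Lemma slack_le_trans n1 n2 a b c :
  slack_le n1 a b -> slack_le n2 b c -> slack_le (n1 + n2) a c.
Proof.
rewrite /slack_le => h1 h2; rewrite !expnD.
have := leq_mul h1 (leqnn (E ^ n2)); rewrite mulnA => /leq_trans -> //.
rewrite -mulnA [E.+1 ^ n1 * _]mulnC mulnA [E.+1 ^ n1 * _]mulnC mulnA.
by rewrite leq_mul2r h2 orbT.
Qed.

Lemma slack_le_sum (I : finType) (P : pred I) n (F G : I -> nat) :
  (forall i, P i -> slack_le n (F i) (G i)) ->
  slack_le n (\sum_(i | P i) F i) (\sum_(i | P i) G i).
Proof.
by move=> h; rewrite /slack_le !big_distrl /=; apply: leq_sum => i; apply: h.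
Qed.

Lemma slack_le_prod (I : finType) (n F G : I -> nat) :
  (forall i, slack_le (n i) (F i) (G i)) ->
  slack_le (\sum_i n i) (\prod_i F i) (\prod_i G i).
Proof.
move=> h; elim/big_rec3: _ => [|i a b s _ ih]; first exact: slack_le0.
by apply: slack_le_mul => //; apply: h.
Qed.

(** For [2 * k <= E] the power [(1 + 1/E)^k] is at most [1 + 2k/E], by induction on [k]; at [k = n]
    this is at most 2. *)
Lemma slack_le_double n a b : 2 * n <= E -> slack_le n a b -> a <= 2 * b.
Proof.
rewrite /slack_le => le h.
have [E0|E0] := posnP E.
  have n0 : n = 0 by lia.
  by move: h; rewrite n0 !expn0; lia.
have key k : k <= n -> E * E.+1 ^ k <= (E + 2 * k) * E ^ k.
  elim: k => [|k ih] lek; first by rewrite !expn0; lia.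
  rewrite !expnS; have {}ih := ih (ltnW lek).
  have h1 : E * (E.+1 * E.+1 ^ k) <= E.+1 * ((E + 2 * k) * E ^ k).
    by rewrite mulnCA leq_mul2l ih orbT.
  apply: leq_trans h1 _; rewrite !mulnA leq_mul2r; apply/orP; right.
  nia.
have h2 : E * E.+1 ^ n <= E * (2 * E ^ n).
  apply: leq_trans (key n (leqnn n)) _.
  by rewrite mulnA leq_mul2r; apply/orP; right; lia.
rewrite leq_pmul2l // in h2.
have h3 : a * E ^ n <= 2 * b * E ^ n.
  by apply: leq_trans h _; rewrite -mulnA mulnCA leq_mul2l h2 orbT.
by rewrite leq_pmul2r ?expn_gt0 ?E0 // in h3.
Qed.

End Slack.

(** * Alias tables *)

(* A cell of capacity Q holds at most two outcomes: offsets below the threshold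
   belong to the first one, the others to the second one. *)
Record cell (I : Type) := Cell {
  threshold : nat; item : bool -> I; base : bool -> nat }.

Definition cell_low I (ce : cell I) (off : nat) : bool := off < threshold ce.

Definition cell_value I (ce : cell I) (off : nat) : I * nat :=
  let b := cell_low ce off in
  (item ce b, base ce b + off - (if b then 0 else threshold ce)).

(** Walker's alias method on integers: each round fills one cell with [Q] units and keeps the
    invariant that the number of outcomes left, minus one, times [Q] is at most the number of units
    left. Only surjectivity is claimed, since an encoder needs just one preimage; the bounds on
    [threshold] and [base] make the cells fit into words. *)
Lemma alias_table (I : finType) (Q : nat) (i0 : I) (p : I -> nat) : 0 < Q ->
  #|[pred i | 0 < p i]|.-1 * Q <= \sum_i p i ->
  exists tab : nat -> cell I,
    (forall n b, threshold (tab n) <= Q /\ base (tab n) b <= \sum_i p i) /\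
    (forall i y, y < p i -> exists2 x, x < \sum_i p i &
       cell_value (tab (x %/ Q)) (x %% Q) = (i, y)).
Proof.
move=> Q0; move: {2}(\sum_i p i) (leqnn (\sum_i p i)) => m.
elim: m p => [|m IH] p Sm hcard.
  exists (fun=> Cell 0 (fun=> i0) (fun=> 0)); split=> // i y lt.
  by have := leq_trans Sm (leq0n y); rewrite (bigD1 i) //=; lia.
have [SQ|SQ] := ltnP (\sum_i p i) Q.
  have [/existsP [i1 pi1]|/existsPn none] := boolP [exists i, 0 < p i]; last first.
    exists (fun=> Cell 0 (fun=> i0) (fun=> 0)); split=> // i y lt.
    by have := none i; lia.
  have c1 : #|[pred i | 0 < p i]| <= 1 by nia.
  exists (fun=> Cell Q (fun=> i1) (fun=> 0)); split=> // i y lt.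
  have -> : i = i1.
    move/card_le1_eqP: c1; apply; rewrite inE //; lia.
  have ltp : y < \sum_i p i.
    have : p i <= \sum_i p i by rewrite (bigD1 i) //= leq_addr.
    by lia.
  exists y => //; rewrite /cell_value /cell_low /= modn_small; last by lia.
  by rewrite ifT ?subn0 //; lia.
have [/existsP [v0 /andP [pv0 v0Q]]|/existsPn none] :=
    boolP [exists i, 0 < p i <= Q]; last first.
  have [v0 v0Q] : exists i, Q < p i.
    have [/existsP [v0 pv0]|/existsPn none0] := boolP [exists i, 0 < p i].
      by exists v0; have := none v0; rewrite pv0 /= -ltnNge.
    suff : \sum_i p i = 0 by lia.
    by rewrite big1 // => i _; have := none0 i; lia.
  (* Every outcome left exceeds [Q], so cutting a whole cell off [v0] keeps their number, and the
     total is large enough to preserve the invariant. *)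
  pose p' i := if i == v0 then p v0 - Q else p i.
  have sp' : \sum_i p' i + Q = \sum_i p i.
    rewrite (bigD1 v0) //= [in RHS](bigD1 v0) //= /p' eqxx.
    under eq_bigr => i /negPf -> do [].
    by lia.
  have pp' i : (0 < p' i) = (0 < p i).
    by rewrite /p'; case: eqP => [->|//]; rewrite subn_gt0; lia.
  have sQ : #|[pred i | 0 < p i]| * Q.+1 <= \sum_i p i.
    rewrite -sum_nat_const big_mkcond /=.
    apply: leq_sum => i _; rewrite inE; case: ifP => // pi.
    by have := none i; rewrite pi /=; lia.
  have [||tab [tab1 tab2]] := IH p'; first by lia.
    rewrite (eq_card (B := [pred i | 0 < p i])); last by move=> i; rewrite !inE pp'.
    move: sQ; rewrite -sp'; case: #|_| => //= k.
    by rewrite mulnS mulSn; lia.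
  exists (fun n => if n is n'.+1 then tab n'
                   else Cell Q (fun=> v0) (fun=> p' v0)); split=> [[|n] b|i y lt].
  - split=> //=; rewrite -sp' (bigD1 v0) //=; lia.
  - by have [h1 h2] := tab1 n b; split=> //; lia.
  have [lty|ley] := ltnP y (p' i).
    have [x ltx <-] := tab2 i y lty.
    exists (x + Q); first by lia.
    by rewrite divnDr // divnn Q0 addn1 modnDr.
  have iv : i = v0 by apply/eqP; move: ley; rewrite /p'; case: eqP => //; lia.
  subst i; exists (y - p' v0).
    have : p v0 <= \sum_i p i by rewrite (bigD1 v0) //= leq_addr.
    by lia.
  have ltQ : y - p' v0 < Q by rewrite /p' eqxx; move: ley; rewrite /p' eqxx; lia.
  rewrite divn_small // modn_small // /cell_value /cell_low /= ltQ.
  by congr (_, _); lia.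
have [/eqP c1|c2] := boolP (#|[pred i | 0 < p i]| == 1).
  have only i : i != v0 -> p i = 0.
    move=> ne; have /card_le1_eqP h : #|[pred i | 0 < p i]| <= 1 by rewrite c1.
    case pi: (p i) => //; move/eqP: ne; case; apply: h; rewrite inE //.
    by rewrite pi.
  have Sp : \sum_i p i = p v0 by rewrite (bigD1 v0) //= big1 ?addn0.
  exists (fun=> Cell Q (fun=> v0) (fun=> 0)); split=> // i y lt.
  have -> : i = v0 by apply/eqP; apply: contraTT lt => /only ->.
  have lty : y < Q.
    have : y < p v0 by move: lt; case: (eqVneq i v0) => [-> //|/only -> //].
    by lia.
  exists y; first by rewrite Sp; move: lt; case: (eqVneq i v0) => [-> //|/only ->].
  by rewrite /cell_value /cell_low /= modn_small // lty subn0.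
(* The cell of the small outcome [v0] is filled up from the largest other outcome [v1]. *)
have [v1 v1v0 max1] : exists2 v1, v1 != v0 & forall i, i != v0 -> p i <= p v1.
  have [v2 v2v0] : exists v2, v2 != v0.
    have /card_gt1P [a [b [_ _ ab]]] : 1 < #|[pred i | 0 < p i]|.
      have : 0 < #|[pred i | 0 < p i]| by apply/card_gt0P; exists v0; rewrite inE.
      by lia.
    by case: (eqVneq a v0) => [av|]; [exists b; rewrite -av eq_sym | exists a].
  have [v1 h1 h2] := arg_maxnP (P := fun i => i != v0) p v2v0.
  by exists v1.
(* Otherwise, with [k] other outcomes of at most [p v1] units each, the total would be below
   [k * Q], against the invariant. *)
have big : Q <= p v0 + p v1.
  rewrite leqNgt; apply/negP => lt.
  have n1 : #|[pred i | 0 < p i]| = #|[pred i | (i != v0) && (0 < p i)]|.+1.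
    by rewrite (cardD1 v0) inE pv0; congr (_.+1); apply: eq_card => i; rewrite !inE.
  have : \sum_i p i <= p v0 + #|[pred i | (i != v0) && (0 < p i)]| * p v1.
    rewrite (bigD1 v0) //= leq_add2l -sum_nat_const big_mkcond [X in _ <= X]big_mkcond /=.
    apply: leq_sum => i _; rewrite inE; case: ifP => //= ne.
    by case: (posnP (p i)) => [->|_] //=; apply: max1; rewrite ne.
  have : 1 < #|[pred i | 0 < p i]|.
    have : 0 < #|[pred i | 0 < p i]| by rewrite n1.
    by lia.
  move: hcard; rewrite n1 /=; set k := #|_|.
  by nia.
pose p' i := if i == v0 then 0 else if i == v1 then p v1 - (Q - p v0) else p i.
have sp' : \sum_i p' i + Q = \sum_i p i.
  rewrite (bigD1 v0) //= [in RHS](bigD1 v0) //= (bigD1 v1) //= [in RHS](bigD1 v1) //=.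
  rewrite /p' eqxx (negPf v1v0) eqxx.
  under eq_bigr => i /andP [/negPf -> /negPf ->] do [].
  by lia.
have card' : #|[pred i | 0 < p' i]|.+1 <= #|[pred i | 0 < p i]|.
  rewrite (cardD1 v0 [pred i | 0 < p i]) inE pv0 ltnS.
  apply: subset_leq_card; apply/subsetP => i; rewrite !inE /p'.
  case: (eqVneq i v0) => //= ne; case: (eqVneq i v1) => [->|//].
  by lia.
have [||tab [tab1 tab2]] := IH p'; first by lia.
  move: hcard card'; rewrite -sp'; move: #|_| => b; case: #|_| => [|a] //=.
  case: b => [|b] //= h1 h2.
  have := leq_mul (h2 : a.+1 <= b) (leqnn Q); rewrite mulSn; lia.
(* The cell takes the top values of [v1], from [p' v1] on; the values below are left unchanged for
   the later cells. *)
exists (fun n => if n is n'.+1 then tab n' else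
   Cell (p v0) (fun b => if b then v0 else v1) (fun b => if b then 0 else p' v1)).
split=> [[|n] b|i y lt].
- split=> //=; case: b => //; rewrite -sp' (bigD1 v1) //=; lia.
- by have [h1 h2] := tab1 n b; split=> //; lia.
have [lty|ley] := ltnP y (p' i).
  have [x ltx <-] := tab2 i y lty.
  exists (x + Q); first by lia.
  by rewrite divnDr // divnn Q0 addn1 modnDr.
case: (eqVneq i v0) => [iv|ne0].
  subst i; exists y; first by lia.
  rewrite divn_small ?modn_small /cell_value /cell_low /=; [|by lia|by lia].
  by rewrite lt subn0.
have iv : i = v1.
  by apply/eqP; move: ley; rewrite /p' (negPf ne0); case: eqP => //; lia.
subst i; have p'v : p' v1 = p v1 - (Q - p v0) by rewrite /p' (negPf v1v0) eqxx.
have ltQ : y - p' v1 + p v0 < Q by lia.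
exists (y - p' v1 + p v0); first by lia.
have ge : (y - p' v1 + p v0 < p v0) = false by lia.
by rewrite divn_small // modn_small // /cell_value /cell_low /= ge; congr (_, _); lia.
Qed.

(** * Merging the spills of siblings *)

(* Bits are taken from the memory when [sflag] is 0 and [smod] a power of two,
   and the value is the spill [s] when [sflag] is 1 and [smod] is 1. *)
Record source := Source { soff : nat; smod : nat; sflag : nat }.

Definition shift_source n x := Source (n + soff x) (smod x) (sflag x).

(** A sum instead of a case split, so that the program needs no branch: modulo 1 the bits read are
    0, and a flag 0 cancels the spill. *)
Definition source_value (D a s : nat) (x : source) : nat :=
  readbits D (a + soff x) (smod x) + s * sflag x.

Record sgroup := SGroup {
  glow : source; gdiv : nat; gmul : nat; ghigh : source; gmod : nat }.

Definition shift_group n g :=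
  SGroup (shift_source n (glow g)) (gdiv g) (gmul g)
        (shift_source n (ghigh g)) (gmod g).

(** A closed group was divided by [gmul]: the remainder was written above a carry from a universe of
    size [gdiv], and the quotient became the carry found in [ghigh]. The last group, which stays
    open, has [gmul = 0]. *)
Definition group_value (D a s : nat) (g : sgroup) : nat :=
  source_value D a s (glow g) %/ gdiv g
  + gmul g * (source_value D a s (ghigh g) %% gmod g).

(** The spill of a child is one digit of its group in mixed radix; [lradix] is the product of the
    universes before it in the group. *)
Record link := Link { lgroup : sgroup; lradix : nat; luniv : nat; loff : nat }.

Definition shift_link n x :=
  Link (shift_group n (lgroup x)) (lradix x) (luniv x) (n + loff x).

Definition link_value (D a s : nat) (x : link) : nat :=
  (group_value D a s (lgroup x) %/ lradix x) %% luniv x.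

Lemma shift_source_value D a s n x :
  source_value D a s (shift_source n x) = source_value D (a + n) s x.
Proof. by rewrite /source_value /= addnA. Qed.

Lemma shift_group_value D a s n g :
  group_value D a s (shift_group n g) = group_value D (a + n) s g.
Proof. by rewrite /group_value /= !shift_source_value. Qed.

Lemma shift_link_value D a s n x :
  link_value D a s (shift_link n x) = link_value D (a + n) s x.
Proof. by rewrite /link_value /= shift_group_value. Qed.

Section Chain.
Context (E2 Th : nat).

(** [2^clen] is about [C Z / E2]. The low part of the group gets universe [cquo], rounded down to
    fit above the old carry, and the high part gets [ccarry], rounded up and of order [E2]. Both are
    at least [E], so each rounding costs a factor of at most [1 + 1/E]. *)
Definition clen C Z := trunc_log 2 (C * Z %/ E2).
Definition cquo C Z := 2 ^ clen C Z %/ C.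
Definition ccarry C Z := (Z %/ cquo C Z).+1.

(* [C] is the universe of the pending carry, [Z] that of the group being
   filled.  As soon as the group reaches [Th] it is closed: its low part is
   written together with the carry, and its high part is the next carry. *)
Fixpoint chain (C Z : nat) (l : seq (nat * nat)) : nat * nat :=
  if l is (M, K) :: l' then
    if Z * K < Th then let r := chain C (Z * K) l' in (M + r.1, r.2)
    else let r := chain (ccarry C (Z * K)) 1 l' in
         (M + (clen C (Z * K) + r.1), r.2)
  else (0, C * Z).

(** The pending carry is the low digit of the word written at the next closing or, if there is none,
    of the final spill; hence the search ahead in the list. *)
Fixpoint carry_source (C Z : nat) (l : seq (nat * nat)) : source :=
  if l is (M, K) :: l' then
    if Z * K < Th then shift_source M (carry_source C (Z * K) l')
    else Source M (2 ^ clen C (Z * K)) 0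
  else Source 0 1 1.

Fixpoint open_group (C Z : nat) (l : seq (nat * nat)) : sgroup :=
  if l is (M, K) :: l' then
    if Z * K < Th then shift_group M (open_group C (Z * K) l')
    else SGroup (Source M (2 ^ clen C (Z * K)) 0) C (cquo C (Z * K))
           (shift_source (M + clen C (Z * K))
              (carry_source (ccarry C (Z * K)) 1 l'))
           (ccarry C (Z * K))
  else SGroup (Source 0 1 1) C 0 (Source 0 1 1) 1.

Fixpoint links (C Z : nat) (l : seq (nat * nat)) : seq link :=
  if l is (M, K) :: l' then
    Link (open_group C Z l) Z K 0 ::
    if Z * K < Th then map (shift_link M) (links C (Z * K) l')
    else map (shift_link (M + clen C (Z * K))) (links (ccarry C (Z * K)) 1 l')
  else [::].

Lemma size_links C Z l : size (links C Z l) = size l.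
Proof.
by elim: l C Z => [|[M K] l IH] C Z //=; case: ifP => _; rewrite size_map IH.
Qed.

Context (E : nat).
Hypotheses (E0 : 0 < E) (EE2 : E <= E2) (hTh : 4 * E * E2 <= Th).

(** From [C Z / E2 < 2 * 2^clen] and [2^clen < C * (cquo + 1)] follows [Z < 2 E2 (cquo + 1)]. With
    the threshold [4 E E2] this forces [cquo >= E], and then the next carry has universe at most
    [4 E2]. *)
Lemma closing_bounds C Z : 0 < C -> Th <= Z ->
  [/\ C * cquo C Z <= 2 ^ clen C Z, 2 ^ clen C Z < C * (cquo C Z).+1,
      E2 * cquo C Z <= Z, E <= cquo C Z &
      E2 < ccarry C Z <= 4 * E2].
Proof.
move=> C0 ThZ; have E20 : 0 < E2 by lia.
have hZ : 4 * E * E2 <= Z by lia.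
have q0 : 0 < C * Z %/ E2 by rewrite divn_gt0 //; nia.
have /andP [l1 l2] := trunc_log_bounds (ltnSn 1) q0.
rewrite -/(clen C Z) in l1 l2.
rewrite leq_divRL // in l1; rewrite ltn_divLR // expnS in l2.
have d1 : C * cquo C Z <= 2 ^ clen C Z by rewrite mulnC leq_trunc_div.
have d2 : 2 ^ clen C Z < C * (cquo C Z).+1.
  by rewrite mulnC ltn_ceil.
set P := 2 ^ _ in l1 l2 d1 d2 *; rewrite /ccarry; set D := cquo C Z in d1 d2 *.
have d3 : E2 * D <= Z.
  rewrite -(leq_pmul2l C0); apply: leq_trans l1.
  by rewrite mulnCA mulnC leq_mul2r d1 orbT.
have d4 : Z < 2 * E2 * D.+1.
  rewrite -(ltn_pmul2l C0); apply: (leq_trans l2).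
  have -> : C * (2 * E2 * D.+1) = 2 * (C * D.+1) * E2 by ring.
  by rewrite leq_mul2r leq_mul2l ltnW ?orbT.
have d5 : E <= D by nia.
have D0 : 0 < D by lia.
split=> //; rewrite ltnS leq_divRL // d3 /= ltn_divLR //; nia.
Qed.

(** The induction takes along the pending carry [c] and the content [z] of the open group, and
    decoding the tail gives both back, because they are written only later. The claim covers every
    string [D] with the right bits at some address, as the final address is not known yet. *)
Lemma chain_exists (l : seq (nat * nat * (nat * nat))) (C Z c z : nat) :
  c < C -> z < Z -> all (fun x => (x.2.1 < 2 ^ x.1.1) && (x.2.2 < x.1.2)) l ->
  let ls := unzip1 l in
  exists mem s, [/\ mem < 2 ^ (chain C Z ls).1, s < (chain C Z ls).2 &
    forall D a, readbits D a (2 ^ (chain C Z ls).1) = mem ->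
    [/\ source_value D a s (carry_source C Z ls) %% C = c,
        group_value D a s (open_group C Z ls) %% Z = z &
        forall i x0 y0, i < size l ->
          readbits D (a + loff (nth x0 (links C Z ls) i))
            (2 ^ (nth y0 l i).1.1) = (nth y0 l i).2.1 /\
          link_value D a s (nth x0 (links C Z ls) i) = (nth y0 l i).2.2]].
Proof.
elim: l C Z c z => [|[[M K] [m k]] l IH] C Z c z cC zZ /=.
  move=> _; exists 0, (c + C * z); split=> // [|D a _].
    by nia.
  have C0 : 0 < C by lia.
  rewrite /group_value /source_value /readbits /= !modn1 !muln1 !add0n.
  split=> //.
    by rewrite addnC mulnC modnMDl modn_small.
  by rewrite mul0n addn0 addnC mulnC divnMDl // divn_small // addn0 modn_small.
move=> /andP [/andP [/= ltm ltk] hl].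
have ltz' : z + Z * k < Z * K by nia.
have Z0 : 0 < Z by lia.
have zmod : (z + Z * k) %% Z = z by rewrite addnC mulnC modnMDl modn_small.
have zdiv : (z + Z * k) %/ Z = k.
  by rewrite addnC mulnC divnMDl // divn_small // addn0.
(* A group known modulo [Z * K] yields both its earlier content and the new digit. *)
have drop n : (n %% (Z * K)) = z + Z * k -> n %% Z = z /\ (n %/ Z) %% K = k.
  move=> hn; split; first by rewrite -zmod -hn modn_dvdm // dvdn_mulr.
  rewrite (divn_eq n (Z * K)) hn.
  have -> : n %/ (Z * K) * (Z * K) + (z + Z * k) = (n %/ (Z * K) * K + k) * Z + z.
    by ring.
  by rewrite divnMDl // [z %/ Z]divn_small // addn0 modnMDl modn_small.
case: ltnP => [lt|ge].
  have [mem [s [hm hs hdec]]] := IH C (Z * K) c (z + Z * k) cC ltz' hl.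
  exists (m + 2 ^ M * mem), s; split=> // [|D a hD]; first exact: cat_lt.
  have hD1 : readbits D (a + M) (2 ^ (chain C (Z * K) (unzip1 l)).1) = mem.
    by rewrite (readbits_sub hD) // readbits_high.
  have [h1 h2 h3] := hdec D (a + M) hD1.
  have [h2z h2k] := drop _ h2.
  rewrite shift_source_value shift_group_value; split=> // -[|i] x0 y0 lti /=.
    rewrite addn0; split; last first.
      by rewrite /link_value /= shift_group_value.
    by have := readbits_sub hD (leq_addr _ M : 0 + M <= _);
       rewrite addn0 => ->; rewrite readbits_low.
  rewrite (nth_map x0) ?size_links ?size_map //=.
  have [h4 h5] := h3 i x0 y0 lti.
  by rewrite shift_link_value addnA.
have C0 : 0 < C by lia.
have [d1 d2 d3 d4 /andP [d5 d6]] := closing_bounds C0 ge.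
move: d1 d2 d3 d4 d5 d6.
set Dq := cquo C _; set L := clen C _; set C' := ccarry C _ => d1 d2 d3 d4 d5 d6.
have D0 : 0 < Dq by lia.
set z' := z + Z * k in ltz' zmod zdiv drop *.
have cC' : z' %/ Dq < C'.
  by rewrite /C' /ccarry -/Dq ltnS leq_div2r // ltnW.
have [mem [s [hm hs hdec]]] := IH C' 1 (z' %/ Dq) 0 cC' (ltnSn 0) hl.
(* The word written at a closing: the old carry as low digit, the remainder of the group above
   it. *)
pose e := c + C * (z' %% Dq).
have lte : e < 2 ^ L.
  apply: leq_trans d1; have := ltn_pmod z' D0; rewrite /e; nia.
exists (m + 2 ^ M * (e + 2 ^ L * mem)), s; split=> // [|D a hD].
  by apply: cat_lt => //; apply: cat_lt.
set Mr := (chain C' 1 (unzip1 l)).1 in hm hs hdec hD *.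
have hD1 : readbits D (a + (M + L)) (2 ^ Mr) = mem.
  rewrite (readbits_sub hD) ?addnA // readbits_mid //.
  by rewrite readbits_high.
have hDe : readbits D (a + M) (2 ^ L) = e.
  rewrite (readbits_sub hD); last by rewrite leq_add2l leq_addr.
  rewrite -[X in readbits _ X]addn0 readbits_mid // readbits_low //.
have [h1 h2 h3] := hdec D _ hD1.
have hg : group_value D a s (SGroup (Source M (2 ^ L) 0) C Dq
     (shift_source (M + L) (carry_source C' 1 (unzip1 l))) C') = z'.
  rewrite /group_value /= shift_source_value h1 /source_value /= hDe muln0 addn0.
  have -> : e %/ C = z' %% Dq.
    by rewrite /e addnC mulnC divnMDl // divn_small // addn0.
  by rewrite mulnC addnC -divn_eq.
split.
- rewrite /source_value /= hDe muln0 addn0 /e addnC mulnC modnMDl modn_small //.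
- by rewrite hg.
move=> [|i] x0 y0 lti /=.
  rewrite addn0; split; last by rewrite /link_value /= hg zdiv modn_small.
  have := readbits_sub hD (leq_addr _ M : 0 + M <= _).
  by rewrite addn0 => ->; rewrite readbits_low.
rewrite (nth_map x0) ?size_links ?size_map //=.
have [h4 h5] := h3 i x0 y0 lti.
by rewrite shift_link_value addnA.
Qed.

Lemma chain_univ_gt0 l C Z : 0 < C -> 0 < Z -> all (fun x => 0 < x.2) l ->
  0 < (chain C Z l).2.
Proof.
elim: l C Z => [|[M K] l IH] C Z C0 Z0 /=; first by rewrite muln_gt0 C0.
by case/andP=> K0 hl; case: ifP => _ /=; apply: IH => //; rewrite muln_gt0 Z0.
Qed.

Lemma chain_univ_ge l C Z : 0 < C -> 0 < Z -> all (fun x => 0 < x.2) l ->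
  E2 <= C * Z -> E2 <= (chain C Z l).2.
Proof.
elim: l C Z => [|[M K] l IH] C Z C0 Z0 //= /andP [K0 hl] h.
case: ltnP => ge /=; apply: IH => //; rewrite ?muln_gt0 ?Z0 //; first by nia.
by have [_ _ _ _] := closing_bounds C0 ge; lia.
Qed.

(** Memory comes from a child with memory, whose universe is at least [E2], or from a closing, whose
    carry is above [E2]; after that the universe cannot fall below [E2] again. *)
Lemma chain_univ_ge_mem l C Z : 0 < C -> 0 < Z ->
  all (fun x => (0 < x.2) && ((0 < x.1) ==> (E2 <= x.2))) l ->
  0 < (chain C Z l).1 -> E2 <= (chain C Z l).2.
Proof.
elim: l C Z => [|[M K] l IH] C Z C0 Z0 //= /andP [/andP [K0 hMK] hl].
have hl0 : all (fun x => 0 < x.2) l by apply: sub_all hl => x /andP [].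
have [M0|M0] := posnP M; last first.
  rewrite M0 /= in hMK.
  case: (ltnP (Z * K) Th) => ge /= _; apply: chain_univ_ge; rewrite ?muln_gt0 ?Z0 //.
    by nia.
  by have [_ _ _ _] := closing_bounds C0 ge; lia.
rewrite M0; case: (ltnP (Z * K) Th) => ge /= h; first by apply: IH; rewrite ?muln_gt0 ?Z0.
apply: chain_univ_ge => //.
by have [_ _ _ _] := closing_bounds C0 ge; lia.
Qed.

(** What remains at the end is a carry of universe at most [4 * E2] and a group that did not reach
    [Th]. *)
Lemma chain_univ_le l C Z : 0 < C <= 4 * E2 -> Z < Th ->
  (chain C Z l).2 <= 4 * E2 * Th.
Proof.
elim: l C Z => [|[M K] l IH] C Z /andP [C0 C4] ZT /=; first by nia.
case: ltnP => ge /=; apply: IH => //; first by rewrite C0.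
  by have [_ _ _ _ /andP [_ ->]] := closing_bounds C0 ge.
by apply: leq_trans hTh; nia.
Qed.

(** Each closing costs two factors [1 + 1/E]. It is charged to the child that triggers it, which has
    [K > 1] because [Z < Th <= Z * K]; children with a one-element universe are free. *)
Lemma chain_slack l C Z : 0 < C -> Z < Th ->
  slack_le E (2 * count (fun x => 1 < x.2) l)
    ((chain C Z l).2 * 2 ^ (chain C Z l).1)
    (C * Z * \prod_(x <- l) (x.2 * 2 ^ x.1)).
Proof.
elim: l C Z => [|[M K] l IH] C Z C0 ZT /=.
  by apply: slack_le0; rewrite big_nil !muln1.
rewrite big_cons /=; case: (ltnP (Z * K) Th) => [lt|ge] /=.
  rewrite expnD mulnCA.
  have -> : C * Z * (K * 2 ^ M * \prod_(x <- l) (x.2 * 2 ^ x.1)) =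
      2 ^ M * (C * (Z * K) * \prod_(x <- l) (x.2 * 2 ^ x.1)) by ring.
  rewrite -[2 * _]add0n; apply: slack_le_mul; first exact: slack_le0.
  by apply: slack_le_weak (IH _ _ C0 lt); lia.
have [d1 d2 d3 d4 /andP [d5 d6]] := closing_bounds C0 ge.
have K1 : 1 < K by nia.
have T1 : 1 < Th by nia.
have D0 : 0 < cquo C (Z * K) by lia.
rewrite K1 mulnDr !expnD.
(* One factor for rounding [2^clen / C] down to [cquo], one for rounding [Z * K / cquo] up to
   [ccarry]. *)
have cl : slack_le E 2 (2 ^ clen C (Z * K) * ccarry C (Z * K)) (C * (Z * K)).
  rewrite /slack_le; move: d1 d2 d3 d4 d5 d6 (leq_trunc_div (Z * K) (cquo C (Z * K))).
  rewrite /ccarry; set P := 2 ^ _; set Z' := Z * K; set D := cquo _ _.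
  set q := Z' %/ D => d1 d2 d3 d4 d5 d6 dq.
  have h1 : P * E <= C * D * E.+1.
    apply: leq_trans (_ : C * D.+1 * E <= _); first by rewrite leq_mul2r ltnW ?orbT.
    by rewrite -!mulnA leq_mul2l; apply/orP; right; nia.
  have h2 : D * q.+1 * E <= Z' * E.+1.
    have : E * D <= Z' by apply: leq_trans d3; rewrite leq_mul2r EE2 orbT.
    rewrite mulnS mulnDl mulnS mulnC => h; apply: leq_add => //.
    by rewrite leq_mul2r mulnC dq orbT.
  have := leq_mul h1 (leqnn (q.+1 * E)).
  have -> : C * D * E.+1 * (q.+1 * E) = C * E.+1 * (D * q.+1 * E) by ring.
  have -> : P * E * (q.+1 * E) = P * q.+1 * E ^ 2 by ring.
  move=> /leq_trans; apply.
  have -> : C * Z' * E.+1 ^ 2 = C * E.+1 * (Z' * E.+1) by ring.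
  by rewrite leq_mul2l h2 orbT.
have ih := IH (ccarry C (Z * K)) 1 isT T1.
rewrite muln1 in ih.
have := slack_le_mul cl (slack_le_trans ih (slack_le0 E (leqnn _))).
set A1 := (chain _ _ _).2; set A2 := 2 ^ (chain _ _ _).1.
set PP := \prod_(_ <- _) _; set c' := ccarry _ _; set L := 2 ^ clen _ _.
move=> h.
have c'0 : 0 < c' by [].
move: h; rewrite /slack_le => h.
rewrite addn0 in h.
(* The product of the two estimates has the universe of the new carry on both sides; it is cancelled
   here. *)
rewrite -(leq_pmul2l c'0).
have := leq_mul (leqnn (2 ^ M)) h.
set e1 := E ^ _; set e2 := E.+1 ^ _ => h'.
have -> : c' * (A1 * (2 ^ M * (L * A2)) * e1) =
    2 ^ M * (L * c' * (A1 * A2) * e1) by ring.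
apply: leq_trans h' _.
by apply: eq_leq; ring.
Qed.

(** Bounds under which the table entries fit into words; the modulus has to be a power of two for
    the program to read bits with it. *)
Definition source_fits O H x :=
  [/\ soff x <= O, smod x <= H, sflag x <= 1 & exists M, smod x = 2 ^ M].

Definition group_fits O H g :=
  [/\ source_fits O H (glow g), source_fits O H (ghigh g),
      gdiv g <= H, gmul g <= H & 0 < gmod g <= H].

Definition link_fits O H x :=
  [/\ group_fits O H (lgroup x), lradix x <= H & luniv x <= H].

Lemma shift_source_fits n O O' H x : n + O <= O' ->
  source_fits O H x -> source_fits O' H (shift_source n x).
Proof. by move=> le [h1 h2 h3 h4]; split=> //=; lia. Qed.

Lemma shift_group_fits n O O' H g : n + O <= O' ->
  group_fits O H g -> group_fits O' H (shift_group n g).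
Proof.
by move=> le [h1 h2 h3 h4 h5]; split=> //=; apply: shift_source_fits le _.
Qed.

Lemma shift_link_fits n O O' H x : n + O <= O' ->
  link_fits O H x -> link_fits O' H (shift_link n x).
Proof. by move=> le [h1 h2 h3]; split=> //=; apply: shift_group_fits le _. Qed.

Context (U H : nat).
Hypotheses (U0 : 0 < U) (hH : 4 * Th * U <= H).

Lemma clen_le C Z K : 0 < C <= 4 * E2 -> Z < Th -> K <= U -> Th <= Z * K ->
  2 ^ clen C (Z * K) <= H.
Proof.
move=> /andP [C0 C4] ZT KU ge; have E20 : 0 < E2 by lia.
have q0 : 0 < C * (Z * K) %/ E2.
  by rewrite divn_gt0 //; apply: leq_trans (_ : Z * K <= _); nia.
have /andP [l1 _] := trunc_log_bounds (ltnSn 1) q0.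
apply: leq_trans l1 _; apply: leq_trans hH.
apply: leq_trans (_ : 4 * E2 * (Z * K) %/ E2 <= _).
  by apply: leq_div2r; rewrite leq_mul2r C4 orbT.
have -> : 4 * E2 * (Z * K) = 4 * (Z * K) * E2 by ring.
by rewrite mulnK // -mulnA leq_mul2l leq_mul // ltnW.
Qed.

Lemma carry_source_fits l C Z : 0 < C <= 4 * E2 -> Z < Th ->
  all (fun x => x.2 <= U) l ->
  source_fits (chain C Z l).1 H (carry_source C Z l).
Proof.
have H1 : 1 <= H by apply: leq_trans hH; nia.
elim: l C Z => [|[M K] l IH] C Z C4 ZT /=; first by split=> //; exists 0.
case/andP=> KU hl; case: (ltnP (Z * K) Th) => ge /=.
  by apply: shift_source_fits (IH _ _ C4 ge hl).
split=> //=; [by lia|exact: clen_le|by eexists].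
Qed.

Lemma open_group_fits l C Z : 0 < C <= 4 * E2 -> Z < Th ->
  all (fun x => x.2 <= U) l ->
  group_fits (chain C Z l).1 H (open_group C Z l).
Proof.
have T1 : 1 < Th by nia.
have H4 : 4 * E2 <= H by apply: leq_trans hH; nia.
elim: l C Z => [|[M K] l IH] C Z C4 ZT /=.
  by split=> //=; [split|split| |]=> //=; (lia || by exists 0).
case/andP=> KU hl; case: (ltnP (Z * K) Th) => ge /=.
  by apply: shift_group_fits (IH _ _ C4 ge hl).
have C0 : 0 < C by case/andP: C4.
have hP := clen_le C4 ZT KU ge.
have [d1 d2 d3 d4 /andP [d5 d6]] := closing_bounds C0 ge.
split=> //=.
- by split=> //=; [lia|eexists].
- apply: shift_source_fits (carry_source_fits _ T1 hl); first by lia.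
  by rewrite d6.
- by lia.
- by apply: leq_trans hP; apply: leq_div.
- by lia.
Qed.

Lemma links_fits l C Z i x0 y0 : 0 < C <= 4 * E2 -> Z < Th ->
  all (fun x => x.2 <= U) l -> i < size l ->
  link_fits (chain C Z l).1 H (nth x0 (links C Z l) i) /\
  loff (nth x0 (links C Z l) i) + (nth y0 l i).1 <= (chain C Z l).1.
Proof.
have T1 : 1 < Th by nia.
have HT : Th <= H by apply: leq_trans hH; nia.
have HU : U <= H by apply: leq_trans hH; nia.
elim: l C Z i => [//|[M K] l IH] C Z i C4 ZT hl.
have := open_group_fits C4 ZT hl.
case: i => [|i] hg /= lti.
  split; last by case: ifP => _ /=; lia.
  move: hl => /andP [KU hl]; split=> //=; [by lia|by apply: leq_trans HU].
move: hl => /andP [KU hl].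
have C0 : 0 < C by case/andP: C4.
case: (ltnP (Z * K) Th) => ge /=.
  rewrite (nth_map x0) ?size_links //=.
  have [h1 h2] := IH _ _ i C4 ge hl lti.
  by split; [apply: shift_link_fits h1|lia].
have [d1 d2 d3 d4 /andP [d5 d6]] := closing_bounds C0 ge.
rewrite (nth_map x0) ?size_links //=.
have C4' : 0 < ccarry C (Z * K) <= 4 * E2 by rewrite d6.
have [h1 h2] := IH _ _ i C4' T1 hl lti.
by split; [apply: shift_link_fits h1; lia|lia].
Qed.

End Chain.

(** * Merging alternatives *)

Section Node.
Context (I : finType) (P : pred I) (mk : I -> nat * nat) (U W0 : nat).

(** In a node with [M] bits, an alternative with less memory moves low bits of its spill into the
    surplus. The cap [W0] is enough for a whole spill and keeps the bits read at once within a
    word. *)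
Definition nbits M v := minn (M - (mk v).1) W0.
Definition nshare M v := ((mk v).2.-1 %/ 2 ^ nbits M v).+1.
Definition ntot M := \sum_(v | P v) nshare M v.
Definition nmax := \max_(v | P v) (mk v).1.
(** The least surplus that brings the universe down to [U]; its being least is what keeps the
    universe above [E2]. *)
Definition nfind := find (fun j => ntot (nmax + j) <= U) (iota 0 W0).
Definition nmem := nmax + nfind.
Definition node := (nmem, ntot nmem).

Context (E E2 : nat).
Hypotheses (E0 : 0 < E) (hE2 : E * #|I| <= E2) (hU : U = 4 * E2).
Hypothesis mk_gt0 : forall v, P v -> 0 < (mk v).2.
Hypothesis mk_le : forall v, P v -> (mk v).2 <= 2 ^ W0.
Hypothesis mk_mem : forall v, P v -> 0 < (mk v).1 -> E2 <= (mk v).2.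

Lemma leq_nmem v : P v -> (mk v).1 <= nmem.
Proof.
by move=> Pv; apply: leq_trans (leq_addr _ _); rewrite /nmax (bigD1 v) //= leq_maxl.
Qed.

(** With [W0] extra bits every spill lies wholly in memory and each share is 1. Since [find] returns
    the length [W0] when it fails, this also covers a failing search. *)
Lemma ntot_stop : ntot (nmax + W0) <= #|I|.
Proof.
rewrite /ntot -sum1_card big_mkcond /=; apply: leq_sum => v _.
case: ifP => // Pv; rewrite /nshare divn_small // /nbits.
have lv : (mk v).1 <= nmax by rewrite /nmax (bigD1 v) //= leq_maxl.
have -> : minn (nmax + W0 - (mk v).1) W0 = W0 by lia.
by have := mk_le Pv; have := mk_gt0 Pv; lia.
Qed.

Lemma ntot_nmem : ntot nmem <= U.
Proof.
rewrite /nmem /nfind; set p := fun j => _.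
have [hp|/hasPn hp] := boolP (has p (iota 0 W0)).
  have := nth_find 0 hp; rewrite /p nth_iota ?add0n //.
  by move: hp; rewrite has_find size_iota.
have -> : find p (iota 0 W0) = W0.
  by rewrite hasNfind ?size_iota //; apply/hasPn.
apply: leq_trans ntot_stop _; nia.
Qed.

Lemma ntot_before : 0 < nfind -> U < ntot nmem.-1.
Proof.
move=> h; have := @before_find _ 0 (fun j => ntot (nmax + j) <= U) (iota 0 W0) nfind.-1.
have lt : nfind.-1 < nfind by lia.
move=> /(_ lt); rewrite nth_iota; last first.
  by apply: leq_trans lt _; rewrite -[X in _ <= X](size_iota 0) find_size.
rewrite add0n /nmem => /negbT; rewrite -ltnNge.
by have -> : nmax + nfind.-1 = (nmax + nfind).-1 by lia.
Qed.

Lemma nshare_mul M v : P v -> (mk v).1 <= M ->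
  nshare M v * 2 ^ M <= (mk v).2 * 2 ^ (mk v).1 + 2 ^ M.
Proof.
move=> Pv le; have K0 := mk_gt0 Pv; have KW := mk_le Pv.
rewrite /nshare /nbits; case: (leqP (M - (mk v).1) W0) => h.
  rewrite mulSn addnC leq_add2r.
  rewrite -{2}(subnK le) expnD mulnA leq_mul2r; apply/orP; right.
  by apply: leq_trans (leq_trunc_div _ _) _; lia.
by rewrite divn_small ?mul1n ?leq_addl //; lia.
Qed.

Lemma ntot_mul M : nmax <= M ->
  ntot M * 2 ^ M <= \sum_(v | P v) (mk v).2 * 2 ^ (mk v).1 + #|I| * 2 ^ M.
Proof.
move=> le; rewrite /ntot big_distrl /= -sum_nat_const [X in _ + X](bigID P) /=.
rewrite addnA -big_split /=; apply: leq_trans (leq_addr _ _).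
apply: leq_sum => v Pv; apply: nshare_mul => //; apply: leq_trans le.
by rewrite /nmax (bigD1 v) //= leq_maxl.
Qed.

Lemma nmax_attained : 0 < nmax -> exists2 v, P v & (mk v).1 = nmax.
Proof.
move=> h.
have [/existsP [v /andP [Pv /eqP hv]]|/existsPn none] :=
  boolP [exists v, P v && ((mk v).1 == nmax)]; first by exists v.
suff : nmax < nmax by rewrite ltnn.
rewrite {1}/nmax; elim/big_ind: _ => // [x y hx hy|v Pv].
  by rewrite gtn_max hx.
rewrite ltn_neqAle; have := none v; rewrite Pv /= => -> /=.
by rewrite /nmax (bigD1 v) //= leq_maxl.
Qed.

(** The rounding error, at most [#|I| * 2^nmem], is then a fraction [1/E] of the sum. If [nfind] is
    0, some alternative uses all the memory and has a universe of at least [E2]; otherwise one bit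
    less would have left more than [U = 4 * E2]. *)
Lemma node_sum_ge : 0 < nmem ->
  E * #|I| * 2 ^ nmem <= \sum_(v | P v) (mk v).2 * 2 ^ (mk v).1.
Proof.
move=> M0; have [f0|f0] := posnP nfind.
  have em : nmem = nmax by rewrite /nmem f0 addn0.
  have [v Pv hv] := nmax_attained (eq_ind _ (fun x => 0 < x) M0 _ em).
  rewrite (bigD1 v) //=; apply: leq_trans (leq_addr _ _).
  rewrite hv -em leq_mul2r (leq_trans hE2) ?orbT //.
  by apply: mk_mem => //; rewrite hv -em.
have h1 := ntot_before f0.
have h2 : nmax <= nmem.-1 by rewrite /nmem; lia.
have h3 := ntot_mul h2.
have h4 : U * 2 ^ nmem.-1 <= \sum_(v | P v) (mk v).2 * 2 ^ (mk v).1 + #|I| * 2 ^ nmem.-1.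
  by apply: leq_trans h3; rewrite leq_mul2r ltnW ?orbT.
have -> : 2 ^ nmem = 2 * 2 ^ nmem.-1 by rewrite -expnS prednK.
have h5 : (2 * (E * #|I|) + #|I|) * 2 ^ nmem.-1 <= U * 2 ^ nmem.-1.
  by rewrite leq_mul2r; apply/orP; right; nia.
by move: h4 h5; rewrite mulnDl mulnCA mulnA; lia.
Qed.

(** One more bit at most halves the universe, and with one bit less it exceeded [4 * E2]; if [nfind]
    is 0, an alternative of maximal memory keeps its universe. *)
Lemma node_univ_ge : 0 < nmem -> E2 <= ntot nmem.
Proof.
move=> M0; have [f0|f0] := posnP nfind.
  have em : nmem = nmax by rewrite /nmem f0 addn0.
  have [v Pv hv] := nmax_attained (eq_ind _ (fun x => 0 < x) M0 _ em).
  rewrite /ntot (bigD1 v) //=; apply: leq_trans (leq_addr _ _).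
  rewrite /nshare /nbits hv em subnn min0n expn0 divn1.
  have : E2 <= (mk v).2 by apply: mk_mem => //; rewrite hv -em.
  by have := mk_gt0 Pv; lia.
have h1 := ntot_before f0.
suff : ntot nmem.-1 <= 2 * ntot nmem by lia.
rewrite /ntot big_distrr /=; apply: leq_sum => v Pv.
rewrite /nshare; set x := (mk v).2.-1.
have he : nbits nmem v <= (nbits nmem.-1 v).+1 by rewrite /nbits; lia.
apply: leq_trans (_ : 2 * (x %/ 2 ^ (nbits nmem.-1 v).+1).+1 <= _); last first.
  by rewrite leq_mul2l ltnS leq_div2l ?expn_gt0 //= leq_exp2l.
rewrite expnSr divnMA; set q := x %/ _.
by have := divn_eq q 2; have := ltn_pmod q (ltn0Sn 1); lia.
Qed.

(** The exponent is the boolean [0 < nmem]: without memory no spill is divided and nothing is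
    lost. *)
Lemma node_slack :
  slack_le E (0 < nmem) (ntot nmem * 2 ^ nmem)
    (\sum_(v | P v) (mk v).2 * 2 ^ (mk v).1).
Proof.
case: posnP => [M0|M0].
  apply: slack_le0; rewrite M0 muln1 /ntot; apply: leq_sum => v Pv.
  rewrite /nshare /nbits sub0n min0n divn1 prednK ?mk_gt0 //.
  by rewrite leq_pmulr ?expn_gt0.
rewrite /slack_le !expn1.
have h1 := node_sum_ge M0.
have h2 := ntot_mul (leq_addr _ _ : nmax <= nmem).
move: h1 h2; set S := \sum_(v | _) _; set p := 2 ^ _; set T := ntot _ => h1 h2.
by nia.
Qed.

Lemma node_univ_gt0 v : P v -> 0 < ntot nmem.
Proof. by move=> Pv; rewrite /ntot (bigD1 v). Qed.

End Node.

(** * Encoding of objects by labels *)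

Section Scheme.
Context (A Lb : finType) (B : nat) (lab : A -> Lb) (child : A -> 'I_B -> A).
Context (inner : pred Lb) (rk leafuniv : Lb -> nat) (leafspill : A -> nat).
Context (E E2 Th U W0 : nat).

Definition childlabs (X : A) : B.-tuple Lb := [tuple lab (child X i) | i < B].

Definition labcard (l : Lb) : nat := #|[set X | lab X == l]|.

Definition valid (l : Lb) (v : B.-tuple Lb) : bool :=
  [exists X, (lab X == l) && (childlabs X == v)].

Definition tuple_layout (F : Lb -> nat * nat) (v : B.-tuple Lb) : nat * nat :=
  chain E2 Th 1 1 [seq F l | l <- v].

(** Fuel is used because ranks are known to decrease only along labels of actual objects. *)
Fixpoint layout_fuel (n : nat) (l : Lb) : nat * nat :=
  if inner l then
    if n is n'.+1 then node (valid l) (tuple_layout (layout_fuel n')) U W0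
    else (0, 1)
  else (0, leafuniv l).

(* The number of bits of memory of an object with label [l], and the size of
   its spill universe. *)
Definition layout (l : Lb) : nat * nat := layout_fuel (rk l) l.

Local Notation tlayout := (tuple_layout layout).

Hypothesis B0 : 0 < B.
Hypothesis rk_child : forall X i, inner (lab X) ->
  rk (lab (child X i)) < rk (lab X).

Lemma node_ext (I : finType) (P : pred I) (mk mk' : I -> nat * nat) :
  (forall v, P v -> mk v = mk' v) -> node P mk U W0 = node P mk' U W0.
Proof.
move=> h; have htot M : ntot P mk W0 M = ntot P mk' W0 M.
  by apply: eq_bigr => v Pv; rewrite /nshare /nbits h.
have hmax : nmax P mk = nmax P mk' by apply: eq_bigr => v Pv; rewrite h.
have hfind : nfind P mk U W0 = nfind P mk' U W0.
  by apply: eq_find => j; rewrite htot hmax.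
by rewrite /node /nmem htot hmax hfind.
Qed.

Lemma layout_fuel_stable n X : rk (lab X) <= n ->
  layout_fuel n (lab X) = layout (lab X).
Proof.
rewrite /layout; move: {2}(rk (lab X)) (leqnn (rk (lab X))) => m.
elim: m n X => [|m IH] n X hm hn.
  case: n {hn} => [|n]; first by move: hm; rewrite leqn0 => /eqP ->.
  move: (rk_child (X := X) (Ordinal B0)) hm; rewrite leqn0.
  case hi: (inner (lab X)); last by move=> _ /eqP -> /=; rewrite hi.
  by move=> /(_ isT) h /eqP h0; rewrite h0 in h.
case hi: (inner (lab X)); last first.
  by case: (rk (lab X)) => [|k]; case: (n) => [|n'] /=; rewrite hi.
have := rk_child (Ordinal B0) hi.
case hk: (rk (lab X)) => [//|k] _; case: n hn => [|n] hn; first by lia.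
rewrite /= hi; apply: node_ext => v /existsP [Y /andP [/eqP hY /eqP <-]].
rewrite /tuple_layout; congr chain; apply/eq_in_map => l /mapP [i _ ->].
have hlt : rk (lab (child Y i)) < rk (lab X) by rewrite -hY rk_child // hY.
by rewrite !IH //; lia.
Qed.

Lemma layout_leaf X : ~~ inner (lab X) -> layout (lab X) = (0, leafuniv (lab X)).
Proof. by rewrite /layout => /negPf h; case: (rk _) => [|n] /=; rewrite h. Qed.

Lemma layout_inner X : inner (lab X) ->
  layout (lab X) = node (valid (lab X)) tlayout U W0.
Proof.
move=> hi; rewrite /layout; have := rk_child (Ordinal B0) hi.
case hk: (rk (lab X)) => [//|k] _ /=; rewrite hi.
apply: node_ext => v /existsP [Y /andP [/eqP hY /eqP <-]].
rewrite /tuple_layout; congr chain; apply/eq_in_map => l /mapP [i _ ->].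
apply: layout_fuel_stable.
have : rk (lab (child Y i)) < rk (lab X) by rewrite -hY rk_child // hY.
by lia.
Qed.

Hypotheses (E0 : 0 < E) (hE2 : E * #|{: B.-tuple Lb}| <= E2).
Hypotheses (hU : U = 4 * E2) (hTh : Th = 4 * E * E2) (hW0 : 4 * E2 * Th <= 2 ^ W0).
Hypothesis leafuniv_le : forall X, ~~ inner (lab X) ->
  leafuniv (lab X) <= labcard (lab X) /\ leafuniv (lab X) <= U.
Hypothesis leafspill_lt : forall X, ~~ inner (lab X) ->
  leafspill X < leafuniv (lab X).
Hypothesis labcard_prod : forall X, inner (lab X) ->
  \prod_(i < B) labcard (lab (child X i)) <=
    #|[set Y | (lab Y == lab X) && (childlabs Y == childlabs X)]|.

Lemma labcard_gt0 X : 0 < labcard (lab X).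
Proof. by apply/card_gt0P; exists X; rewrite inE. Qed.

Lemma leq_E_E2 (X : A) : E <= E2.
Proof.
apply: leq_trans hE2; rewrite leq_pmulr //.
by apply/card_gt0P; exists (childlabs X).
Qed.

(** The third part keeps the roundings at the parent small. In the fourth, a level spends at most
    [3 log N]: two units for each closing, charged to a child with [log N >= 1], and one for
    rounding the shares. The logarithms of the children add up to at most that of the object, so
    only the number of levels multiplies. *)
Definition layout_ok (X : A) : Prop :=
  [/\ 0 < (layout (lab X)).2, (layout (lab X)).2 <= U,
      0 < (layout (lab X)).1 -> E2 <= (layout (lab X)).2 &
      slack_le E (3 * rk (lab X) * trunc_log 2 (labcard (lab X)))
        ((layout (lab X)).2 * 2 ^ (layout (lab X)).1) (labcard (lab X))].

(** If [N = 1] the budget is 0 and [K * 2^M <= 1]. Hence a child with [K > 1] can pay for a closing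
    with its own logarithm. *)
Lemma layout_ok_nontrivial X : layout_ok X ->
  (1 < (layout (lab X)).2) <= trunc_log 2 (labcard (lab X)).
Proof.
case=> _ _ _ hs; case: ltnP => // h.
rewrite lt0n; apply/eqP => h0; move: hs; rewrite h0 muln0 /slack_le !muln1.
have : labcard (lab X) < 2.
  by rewrite ltnNge; apply/negP => h2; have := trunc_log_gt0 2 (labcard (lab X)); rewrite h0 h2.
have : 0 < 2 ^ (layout (lab X)).1 by rewrite expn_gt0.
by nia.
Qed.

Lemma tuple_layout_bounds X : (forall i, layout_ok (child X i)) ->
  [/\ 0 < (tlayout (childlabs X)).2, (tlayout (childlabs X)).2 <= 2 ^ W0 &
      0 < (tlayout (childlabs X)).1 -> E2 <= (tlayout (childlabs X)).2].
Proof.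
move=> ok; have EE2 := leq_E_E2 X.
have hT : 4 * E * E2 <= Th by rewrite hTh.
have T1 : 1 < Th by rewrite hTh; nia.
split.
- apply: chain_univ_gt0 => //; apply/allP => x /mapP [l /mapP [i _ ->] ->].
  by have [] := ok i.
- apply: leq_trans hW0; apply: (chain_univ_le E0 EE2 hT) => //; lia.
- apply: (chain_univ_ge_mem E0 EE2 hT) => //.
  apply/allP => x /mapP [l /mapP [i _ ->] ->].
  have [h1 h2 h3 h4] := ok i; rewrite h1 /=; apply/implyP; exact: h3.
Qed.

Lemma tuple_layout_slack X : inner (lab X) -> (forall i, layout_ok (child X i)) ->
  slack_le E ((3 * (rk (lab X)).-1 + 2) * trunc_log 2 (labcard (lab X)))
    ((tlayout (childlabs X)).2 * 2 ^ (tlayout (childlabs X)).1)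
    (\prod_(i < B) labcard (lab (child X i))).
Proof.
move=> hi ok; have EE2 := leq_E_E2 X.
have hT : 4 * E * E2 <= Th by rewrite hTh.
have T1 : 1 < Th by rewrite hTh; nia.
have h1 := chain_slack E0 EE2 hT [seq layout l | l <- childlabs X] (ltn0Sn 0) T1.
rewrite !mul1n big_map big_tuple in h1.
have h2 : slack_le E (\sum_(i < B) 3 * rk (lab (child X i)) *
      trunc_log 2 (labcard (lab (child X i))))
    (\prod_(i < B) ((layout (lab (child X i))).2 * 2 ^ (layout (lab (child X i))).1))
    (\prod_(i < B) labcard (lab (child X i))).
  by apply: slack_le_prod => i; have [] := ok i.
have e1 : \prod_(i < B) ((layout (tnth (childlabs X) i)).2 *
       2 ^ (layout (tnth (childlabs X) i)).1) =
    \prod_(i < B) ((layout (lab (child X i))).2 * 2 ^ (layout (lab (child X i))).1).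
  by apply: eq_bigr => i _; rewrite tnth_mktuple.
rewrite e1 in h1.
apply: slack_le_weak (slack_le_trans h1 h2).
(* The powers of two below the counts of the children multiply to at most the product of these
   counts, which [labcard_prod] bounds. *)
have hlog : \sum_(i < B) trunc_log 2 (labcard (lab (child X i))) <=
    trunc_log 2 (labcard (lab X)).
  apply: trunc_log_max => //.
  apply: leq_trans (_ : \prod_(i < B) labcard (lab (child X i)) <= _); last first.
    apply: leq_trans (labcard_prod hi) _; apply: subset_leq_card.
    by apply/subsetP => Y; rewrite !inE => /andP [].
  rewrite expn_sum; apply: leq_prod => i _.
  by apply: trunc_logP => //; apply: labcard_gt0.
apply: leq_trans (_ : (3 * (rk (lab X)).-1 + 2) *
   \sum_(i < B) trunc_log 2 (labcard (lab (child X i))) <= _); last first.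
  by rewrite leq_mul2l hlog orbT.
rewrite mulnDl addnC; apply: leq_add.
  rewrite big_distrr /=; apply: leq_sum => i _; rewrite leq_mul2r; apply/orP; right.
  by have := rk_child i hi; lia.
rewrite leq_mul2l /= count_map -sum1_count big_mkcond (big_tuple _ _ (childlabs X)) /=.
apply: leq_sum => i _; rewrite tnth_mktuple.
by have := layout_ok_nontrivial (ok i); case: ltnP.
Qed.

Lemma layout_okP X : layout_ok X.
Proof.
move: {2}(rk (lab X)) (leqnn (rk (lab X))) => m.
elim: m X => [|m IH] X hm.
all: case: (boolP (inner (lab X))) => hi; last first.
1,3: have [l1 l2] := leafuniv_le hi; have l3 := leafspill_lt hi;
  rewrite /layout_ok layout_leaf // muln1; split=> //=; first (by lia);
  by apply: slack_le_weak (slack_le0 E l1).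
  by have := rk_child (Ordinal B0) hi; lia.
have okv Y : lab Y = lab X -> forall i, layout_ok (child Y i).
  move=> hY i; apply: IH.
  have : rk (lab (child Y i)) < rk (lab X) by rewrite -hY rk_child // hY.
  by lia.
have bnd v : valid (lab X) v -> [/\ 0 < (tlayout v).2, (tlayout v).2 <= 2 ^ W0 &
      0 < (tlayout v).1 -> E2 <= (tlayout v).2].
  move=> /existsP [Y /andP [/eqP hY /eqP <-]].
  by apply: tuple_layout_bounds; apply: okv.
have b1 v : valid (lab X) v -> 0 < (tlayout v).2 by case/bnd.
have b2 v : valid (lab X) v -> (tlayout v).2 <= 2 ^ W0 by case/bnd.
have b3 v : valid (lab X) v -> 0 < (tlayout v).1 -> E2 <= (tlayout v).2 by case/bnd.
have vX : valid (lab X) (childlabs X) by apply/existsP; exists X; rewrite !eqxx.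
rewrite /layout_ok layout_inner //=; split.
- exact: node_univ_gt0 vX.
- exact: (ntot_nmem E0 hE2 hU b1 b2).
- exact: (node_univ_ge E0 hE2 hU b1 b3).
have h1 := node_slack E0 hE2 hU b1 b2 b3.
(* The objects with this label are partitioned by the labels of their children, and each alternative
   is compared with its own block. *)
have h2 : slack_le E ((3 * (rk (lab X)).-1 + 2) * trunc_log 2 (labcard (lab X)))
   (\sum_(v | valid (lab X) v) (tlayout v).2 * 2 ^ (tlayout v).1) (labcard (lab X)).
  rewrite -[X in slack_le _ X]addn0.
  apply: (slack_le_trans (b := \sum_(v | valid (lab X) v)
      #|[set Y | (lab Y == lab X) && (childlabs Y == v)]|)).
    apply: slack_le_sum => v /existsP [Y /andP [/eqP hY /eqP <-]].
    have hiY : inner (lab Y) by rewrite hY.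
    rewrite -hY -[X in slack_le _ X]addn0.
    apply: slack_le_trans (tuple_layout_slack hiY (okv Y hY)) _.
    by apply: slack_le0; apply: labcard_prod.
  apply: slack_le0; rewrite /labcard -sum1_card.
  rewrite (partition_big childlabs (valid (lab X))) /=; last first.
    by move=> Y; rewrite inE => hY; apply/existsP; exists Y; rewrite hY eqxx.
  apply: leq_sum => v _; rewrite -sum1_card; apply: eq_leq.
  by apply: eq_bigl => Y; rewrite !inE.
apply: slack_le_weak (slack_le_trans h1 h2).
have rk0 : 0 < rk (lab X) by have := rk_child (Ordinal B0) hi; lia.
set r := rk _ in rk0 *; set tl := trunc_log _ _.
(* The logarithm also pays for the rounding of the node: were it 0, the alternatives would weigh
   less than 2 in total, while a node with memory has weight at least [2^nmem]. *)
suff : (0 < nmem (valid (lab X)) tlayout U W0) <= tl by nia.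
case: posnP => // M0; rewrite lt0n; apply/eqP => tl0.
have h3 := node_sum_ge E0 hE2 hU b1 b2 b3 M0.
move: h2; rewrite -/tl tl0 muln0 /slack_le !muln1.
have : labcard (lab X) < 2.
  rewrite ltnNge; apply/negP => h4; have := trunc_log_gt0 2 (labcard (lab X)).
  by rewrite -/tl tl0 h4.
have : 0 < #|{: B.-tuple Lb}| by apply/card_gt0P; exists (childlabs X).
have : 2 <= 2 ^ nmem (valid (lab X)) tlayout U W0.
  by rewrite -{1}(expn1 2) leq_exp2l.
move: h3; set S := \sum_(v | _) _; set p := 2 ^ _; set V := #|_|.
by nia.
Qed.

Lemma valid_childlabs X : valid (lab X) (childlabs X).
Proof. by apply/existsP; exists X; rewrite !eqxx. Qed.

Definition ncells : nat := #|{: B.-tuple Lb}|.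
(** This makes fewer than [2 * ncells] cells and satisfies the condition of [alias_table]. Where
    [K < ncells] the quantum is 1, and the condition holds because each of the counted shares is at
    least 1. *)
Definition quantum (l : Lb) : nat := maxn 1 ((layout l).2 %/ ncells).

Definition share (l : Lb) (v : B.-tuple Lb) : nat :=
  if valid l v then nshare tlayout W0 (layout l).1 v else 0.

Definition alias_spec (l : Lb) (tab : nat -> cell (B.-tuple Lb)) : Prop :=
  (forall n b, threshold (tab n) <= quantum l /\ base (tab n) b <= (layout l).2) /\
  (forall v y, y < share l v -> exists2 x, x < (layout l).2 &
     cell_value (tab (x %/ quantum l)) (x %% quantum l) = (v, y)).

Lemma alias_exists X : inner (lab X) -> exists tab, alias_spec (lab X) tab.
Proof.
move=> hi; have [K0 KU _ _] := layout_okP X.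
have eK : (layout (lab X)).2 = \sum_v share (lab X) v.
  by rewrite /share -big_mkcond /= layout_inner.
have [|tab [h1 h2]] := @alias_table _ (quantum (lab X)) (childlabs X) (share (lab X))
    (leq_maxl _ _).
  have n1 : #|[pred v | 0 < share (lab X) v]| <= \sum_v share (lab X) v.
    rewrite -sum1_card big_mkcond /=; apply: leq_sum => v _; rewrite inE.
    by case: ifP.
  have n2 : #|[pred v | 0 < share (lab X) v]| <= ncells by apply: max_card.
  rewrite /quantum eK; move: n1 n2; set n := #|_|; set S := \sum_v _ => n1 n2.
  have q := leq_trunc_div S ncells.
  by case: (leqP 1 (S %/ ncells)) => h; nia.
by exists tab; rewrite /alias_spec eK.
Qed.

Context (alias : Lb -> nat -> cell (B.-tuple Lb)).
Hypothesis aliasP : forall X, inner (lab X) -> alias_spec (lab X) (alias (lab X)).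

Definition select (l : Lb) (x : nat) : B.-tuple Lb * nat :=
  cell_value (alias l (x %/ quantum l)) (x %% quantum l).

Definition extra_bits (l : Lb) (v : B.-tuple Lb) : nat :=
  nbits tlayout W0 (layout l).1 v.

(** The bits moved out of the merged spill lie right behind the memory of the children. *)
Definition tuple_spill (D a : nat) (l : Lb) (v : B.-tuple Lb) (y : nat) : nat :=
  y * 2 ^ extra_bits l v + readbits D (a + (tlayout v).1) (2 ^ extra_bits l v).

Definition nolink := Link (SGroup (Source 0 0 0) 0 0 (Source 0 0 0) 0) 0 0 0.

Definition child_link (v : B.-tuple Lb) (i : nat) : link :=
  nth nolink (links E2 Th 1 1 [seq layout l | l <- v]) i.

(* [encodes O D a x X]: decoding the data [D] from bit address [a] on, with
   spill [x], runs through the tree of [X], without leaving the first [O] bits. *)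
Inductive encodes (O D : nat) : nat -> nat -> A -> Prop :=
| EncLeaf a x X : ~~ inner (lab X) -> x < (layout (lab X)).2 ->
    x = leafspill X -> a <= O -> encodes O D a x X
| EncInner a x X y s : inner (lab X) -> x < (layout (lab X)).2 ->
    a + (layout (lab X)).1 <= O ->
    select (lab X) x = (childlabs X, y) ->
    s = tuple_spill D a (lab X) (childlabs X) y ->
    (forall i : 'I_B, encodes O D (a + loff (child_link (childlabs X) i))
       (link_value D a s (child_link (childlabs X) i)) (child X i)) ->
    encodes O D a x X.

Lemma nth_childlabs X l0 (i : 'I_B) : nth l0 (childlabs X) i = lab (child X i).
Proof. by rewrite -tnth_nth tnth_mktuple. Qed.

(** The encoder: [chain_exists] merges the children into memory and a spill [s]; the low bits of [s]
    go behind that memory, and a preimage in the alias table turns the rest into the spill of the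
    node. *)
Lemma encodes_exists X : exists mem x,
  [/\ mem < 2 ^ (layout (lab X)).1, x < (layout (lab X)).2 &
      forall O D a, readbits D a (2 ^ (layout (lab X)).1) = mem ->
        a + (layout (lab X)).1 <= O -> encodes O D a x X].
Proof.
move: {2}(rk (lab X)) (leqnn (rk (lab X))) => m.
elim: m X => [|m IH] X hm.
all: case: (boolP (inner (lab X))) => hi; last first.
1,3: exists 0, (leafspill X); rewrite layout_leaf //; split=> // [|O D a _ hO];
  [exact: leafspill_lt|apply: EncLeaf => //; rewrite ?layout_leaf //];
  [exact: leafspill_lt|by move: hO; rewrite addn0].
  by have := rk_child (Ordinal B0) hi; lia.
have {}IH i : exists mx : nat * nat,
  [/\ mx.1 < 2 ^ (layout (lab (child X i))).1, mx.2 < (layout (lab (child X i))).2 &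
      forall O D a, readbits D a (2 ^ (layout (lab (child X i))).1) = mx.1 ->
        a + (layout (lab (child X i))).1 <= O -> encodes O D a mx.2 (child X i)].
  have [|mem [x h]] := IH (child X i); last by exists (mem, x).
  by have := rk_child i hi; lia.
have [mx hmx] := boolp.choice IH.
have EE2 := leq_E_E2 X.
have hT : 4 * E * E2 <= Th by rewrite hTh.
have T1 : 1 < Th by rewrite hTh; nia.
pose l := [seq (layout (lab (child X i)), mx i) | i <- enum 'I_B].
have el : unzip1 l = [seq layout l | l <- childlabs X].
  by rewrite /l /unzip1 -map_comp /= -map_comp; apply: eq_map.
have szl : size l = B by rewrite size_map size_enum_ord.
have [|mem [s [hmem hs hdec]]] := chain_exists E0 EE2 hT (ltnSn 0) (ltnSn 0) (l := l).
  by apply/allP => _ /mapP [i _ ->] /=; have [-> ->] := hmx i.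
rewrite el -/(tlayout (childlabs X)) in hmem hs hdec.
have vX := valid_childlabs X.
set v := childlabs X in hmem hs hdec vX.
have ok i := layout_okP (child X i).
have [v0 vle _] := tuple_layout_bounds ok.
pose e := extra_bits (lab X) v.
have eM : (tlayout v).1 + e <= (layout (lab X)).1.
  have : (tlayout v).1 <= (layout (lab X)).1 by rewrite layout_inner //=; apply: leq_nmem.
  by rewrite /e /extra_bits /nbits; lia.
have [x hx hch] : exists2 x, x < (layout (lab X)).2 &
    select (lab X) x = (v, s %/ 2 ^ e).
  have [_ h] := aliasP hi; apply: h; rewrite /share vX /nshare -/e ltnS.
  by apply: leq_div2r; lia.
have lte : s %% 2 ^ e < 2 ^ e by rewrite ltn_pmod ?expn_gt0.
exists (mem + 2 ^ (tlayout v).1 * (s %% 2 ^ e)), x; split=> //.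
  by apply: leq_trans (cat_lt hmem lte) _; rewrite leq_exp2l.
move=> O D a hD hO.
have hD1 : readbits D a (2 ^ (tlayout v).1) = mem.
  have := readbits_sub hD (_ : 0 + (tlayout v).1 <= _); rewrite addn0 => -> //.
    by rewrite readbits_low.
  by lia.
have hs' : s = tuple_spill D a (lab X) v (s %/ 2 ^ e).
  rewrite /tuple_spill -/e (readbits_sub hD eM) readbits_high //.
  exact: divn_eq.
have [_ _ h3] := hdec D a hD1.
apply: (EncInner hi hx hO hch hs') => i.
have iB : i < size l by rewrite szl.
have [h4 h5] := h3 i nolink (layout (lab (child X i)), mx i) iB.
have enth : nth (layout (lab (child X i)), mx i) l i = (layout (lab (child X i)), mx i).
  by rewrite (nth_map i) ?size_enum_ord // nth_ord_enum.
rewrite enth /= in h4 h5.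
have [_ _ h6] := hmx i; rewrite /child_link h5; apply: h6 => //.
have hall : all (fun x => x.2 <= U) [seq layout l | l <- v].
  by apply/allP => y /mapP [l0 /mapP [j _ ->] ->]; have [] := ok j.
have U0 : 0 < U by rewrite hU; lia.
have C4 : 0 < 1 <= 4 * E2 by lia.
have iv : i < size [seq layout l | l <- v] by rewrite size_map size_tuple.
have [_] := links_fits E0 EE2 hT U0 (leqnn _) nolink (0, 0) C4 T1 hall iv.
rewrite (nth_map (lab X)) ?size_tuple // nth_childlabs -/(tlayout v).
move=> hl; apply: leq_trans hO; rewrite -addnA leq_add2l.
apply: leq_trans hl _; exact: leq_trans (leq_addr _ _) eM.
Qed.

End Scheme.

(** * Straight-line programs *)

Definition bits_of (n L : nat) : bitseq := mkseq (fun i => odd (n %/ 2 ^ i)) L.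

Lemma sum_bits m W : \sum_(i < W) odd (m %/ 2 ^ i) * 2 ^ i = m %% 2 ^ W.
Proof.
elim: W => [|W IH]; first by rewrite big_ord0 modn1.
rewrite big_ord_recr /= IH -modn2 expnSr.
rewrite [in RHS](divn_eq m (2 ^ W)) [in RHS](divn_eq (m %/ 2 ^ W) 2).
rewrite mulnDl -addnA -mulnA [2 * _]mulnC modnMDl [RHS]modn_small; first by rewrite addnC.
have := ltn_pmod (m %/ 2 ^ W) (ltn0Sn 1).
have : m %% 2 ^ W < 2 ^ W by rewrite ltn_pmod ?expn_gt0.
by nia.
Qed.

Lemma data_word_bits_of W n L j : n < 2 ^ L ->
  data_word W (bits_of n L) j = readbits n (j * W) (2 ^ W).
Proof.
move=> lt; rewrite /data_word /readbits -sum_bits; apply: eq_bigr => i _.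
rewrite -divnMA -expnD; congr (nat_of_bool _ * _).
case: (ltnP (j * W + i) L) => h; first by rewrite nth_mkseq.
rewrite nth_default ?size_mkseq // divn_small //.
by apply: leq_trans lt _; rewrite leq_exp2l.
Qed.

Inductive expr :=
| Reg (n : nat)
| Imm (n : nat)
| Bin (o : binop) (e1 e2 : expr)
| Tab (e : expr)
| Dat (e : expr).

Fixpoint expr_vars (n : nat) (e : expr) : bool :=
  match e with
  | Reg k => k < n
  | Imm _ => true
  | Bin _ e1 e2 => expr_vars n e1 && expr_vars n e2
  | Tab e | Dat e => expr_vars n e
  end.

Fixpoint expr_cost (e : expr) : nat :=
  match e with
  | Reg _ | Imm _ => 1
  | Bin _ e1 e2 => expr_cost e1 + (expr_cost e2 + 1)
  | Tab e | Dat e => expr_cost e + 1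
  end.

(* [Op And b n n] copies register [n] to register [b]. *)
Fixpoint expr_code (b : nat) (e : expr) : cmd :=
  match e with
  | Reg n => Op And b n n
  | Imm n => Const b n
  | Bin o e1 e2 => Seq (expr_code b e1) (Seq (expr_code b.+1 e2) (Op o b b b.+1))
  | Tab e => Seq (expr_code b e) (LoadTable b b)
  | Dat e => Seq (expr_code b e) (LoadData b b)
  end.

(* Registers below [nvars] are the variables, the others are scratch. *)
Definition nvars : nat := 12.

Definition block := seq (nat * expr).

Definition block_vars (l : block) : bool :=
  all (fun x => (x.1 < nvars) && expr_vars nvars x.2) l.

(** The closing [Const] writes to a scratch register and serves as the empty program. *)
Fixpoint block_code (l : block) : cmd :=
  if l is (d, e) :: l' then
    Seq (Seq (expr_code nvars e) (Op And d nvars nvars)) (block_code l')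
  else Const nvars 0.

Fixpoint block_cost (l : block) : nat :=
  if l is (d, e) :: l' then expr_cost e + 1 + block_cost l' else 1.

Section Machine.
Context (W : nat) (T : seq nat) (D : bitseq) (S : Type).
Context (ask : S -> nat -> nat -> S -> Prop).

Fixpoint expr_eval (r : regs) (e : expr) : nat :=
  match e with
  | Reg n => r n
  | Imm n => n %% 2 ^ W
  | Bin o e1 e2 => eval_binop W o (expr_eval r e1) (expr_eval r e2)
  | Tab e => nth 0 T (expr_eval r e)
  | Dat e => data_word W D (expr_eval r e)
  end.

Fixpoint block_run (r : regs) (l : block) : regs :=
  if l is (d, e) :: l' then block_run (upd r d (expr_eval r e)) l' else r.

Lemma expr_eval_ext n e r r' : expr_vars n e -> (forall k, k < n -> r k = r' k) ->
  expr_eval r e = expr_eval r' e.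
Proof.
move=> + h; elim: e => [k|k|o e1 IH1 e2 IH2|e IH|e IH] //=.
- exact: h.
- by case/andP=> /IH1 -> /IH2 ->.
- by move=> /IH ->.
- by move=> /IH ->.
Qed.

Lemma expr_code_exec n e b r s : expr_vars n e -> n <= b -> exists r',
  [/\ exec W T D ask (expr_code b e) r s (expr_cost e) r' s,
      r' b = expr_eval r e & forall k, k < b -> r' k = r k].
Proof.
elim: e b r => [k|k|o e1 IH1 e2 IH2|e IH|e IH] b r /=.
- move=> _ _; exists (upd r b (r k)); split.
  + by rewrite -[X in upd r b X]PeanoNat.Nat.land_diag; apply: (ExOp _ _ _ _ And).
  + by rewrite /upd eqxx.
  + by move=> j hj; rewrite /upd ltn_eqF.
- move=> _ _; exists (upd r b (k %% 2 ^ W)); split; first exact: ExConst.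
  + by rewrite /upd eqxx.
  + by move=> j hj; rewrite /upd ltn_eqF.
- case/andP=> h1 h2 nb.
  have [r1 [x1 v1 k1]] := IH1 b r h1 nb.
  have [r2 [x2 v2 k2]] := IH2 b.+1 r1 h2 (leqW nb).
  exists (upd r2 b (eval_binop W o (r2 b) (r2 b.+1))); split.
  + exact: ExSeq x1 (ExSeq x2 (ExOp _ _ _ _ _ _ _ _ _ _)).
  + rewrite /upd eqxx v2 k2 // v1; congr eval_binop.
    by apply: expr_eval_ext h2 _ => k hk; apply: k1; apply: leq_trans nb.
  + by move=> j hj; rewrite /upd ltn_eqF // k2 ?k1 //; apply: ltnW.
- move=> h nb; have [r1 [x1 v1 k1]] := IH b r h nb.
  exists (upd r1 b (nth 0 T (r1 b))); split.
  + exact: ExSeq x1 (ExLoadTable _ _ _ _ _ _ _ _).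
  + by rewrite /upd eqxx v1.
  + by move=> j hj; rewrite /upd ltn_eqF // k1.
- move=> h nb; have [r1 [x1 v1 k1]] := IH b r h nb.
  exists (upd r1 b (data_word W D (r1 b))); split.
  + exact: ExSeq x1 (ExLoadData _ _ _ _ _ _ _ _).
  + by rewrite /upd eqxx v1.
  + by move=> j hj; rewrite /upd ltn_eqF // k1.
Qed.

Lemma block_exec l r r0 s : block_vars l -> (forall k, k < nvars -> r k = r0 k) ->
  exists2 r', exec W T D ask (block_code l) r s (block_cost l) r' s &
    forall k, k < nvars -> r' k = block_run r0 l k.
Proof.
elim: l r r0 => [|[d e] l IH] r r0 /=.
  move=> _ h; exists (upd r nvars (0 %% 2 ^ W)); first exact: ExConst.
  by move=> k hk; rewrite /upd ltn_eqF // h.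
case/andP=> /andP [hd he] hl h.
have [r1 [x1 v1 k1]] := expr_code_exec r s he (leqnn _).
have [|r2 x2 h2] := IH (upd r1 d (r1 nvars)) (upd r0 d (expr_eval r0 e)) hl.
  move=> k hk; rewrite /upd; case: eqP => // _; last by rewrite k1 ?h.
  by rewrite v1; apply: expr_eval_ext he h.
exists r2 => //; apply: ExSeq x2; apply: ExSeq x1 _.
by rewrite -[X in upd r1 d X]PeanoNat.Nat.land_diag; apply: (ExOp _ _ _ _ And).
Qed.

End Machine.

(** * The query program *)

(* The tables are interleaved: entry [n] of table [f] is at address [f + 32 n]. *)
Definition lookup (f : nat) (e : expr) : expr :=
  Tab (Bin Add (Imm f) (Bin Mul (Imm 32) e)).

Definition header (f : nat) : expr := Tab (Imm f).

(* Bits of the data from the address in variable 4 on. *)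
Definition bits (P : expr) : expr :=
  Bin Mod
    (Bin Add
      (Bin Shr (Dat (Bin Div (Reg 4) (header 1))) (Bin Mod (Reg 4) (header 1)))
      (Bin Shl (Dat (Bin Add (Bin Div (Reg 4) (header 1)) (Imm 1)))
        (Bin Defs.Sub (header 1) (Bin Mod (Reg 4) (header 1)))))
    P.

(* Variables 0, 1, 2 hold the label of the current node, its spill and the bit
   address of its memory, and variable 3 tells whether it is an inner node. *)
Definition init_block : block :=
  [:: (0, Bin Add (Bin Mul (Reg 0) (header 0)) (Reg 1));
      (4, lookup 5 (Reg 0));
      (1, bits (lookup 6 (Reg 0)));
      (2, Imm 0);
      (3, lookup 4 (Reg 0))].

(** Variable 5 is the number of a cell, then of its selected half, with the comparison to the
    threshold as last bit; 10 is the offset, then the value within the share; 7 is the word for the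
    query, 6 the merged spill. *)
Definition choice_block : block :=
  [:: (5, Bin Add (Bin Mul (Bin Div (Reg 1) (lookup 7 (Reg 0))) (header 2)) (Reg 0));
      (10, Bin Mod (Reg 1) (lookup 7 (Reg 0)));
      (5, Bin Add (Bin Mul (Reg 5) (Imm 2)) (Bin Lt (Reg 10) (lookup 10 (Reg 5))));
      (7, lookup 11 (Reg 5));
      (10, Bin Defs.Sub (Bin Add (lookup 12 (Reg 5)) (Reg 10)) (lookup 13 (Reg 5)));
      (4, Bin Add (Reg 2) (lookup 15 (Reg 5)));
      (6, Bin Add (Bin Mul (Reg 10) (lookup 14 (Reg 5))) (bits (lookup 14 (Reg 5))))].

(** Variable 9 numbers the pair of tuple and child; 10 and 11 are the low and the high part of the
    child's group. Variable 2 changes only after all reads, being their base address. *)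
Definition descend_block : block :=
  [:: (9, Bin Add (Bin Mul (Reg 7) (header 3)) (Reg 8));
      (4, Bin Add (Reg 2) (lookup 16 (Reg 9)));
      (10, Bin Div (Bin Add (bits (lookup 17 (Reg 9)))
                            (Bin Mul (Reg 6) (lookup 18 (Reg 9))))
                   (lookup 19 (Reg 9)));
      (4, Bin Add (Reg 2) (lookup 21 (Reg 9)));
      (11, Bin Mod (Bin Add (bits (lookup 22 (Reg 9)))
                            (Bin Mul (Reg 6) (lookup 23 (Reg 9))))
                   (lookup 24 (Reg 9)));
      (1, Bin Mod (Bin Div (Bin Add (Reg 10) (Bin Mul (lookup 20 (Reg 9)) (Reg 11)))
                           (lookup 25 (Reg 9)))
                  (lookup 26 (Reg 9)));
      (2, Bin Add (Reg 2) (lookup 27 (Reg 9)));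
      (0, lookup 28 (Reg 9));
      (3, lookup 4 (Reg 0))].

(** The factor from table 8 replaces a branch: it makes the result 0 for objects of size 0. *)
Definition leaf_block : block :=
  [:: (1, Bin Mul (lookup 8 (Reg 0)) (lookup 29 (Bin Add (lookup 9 (Reg 0)) (Reg 1))))].

Definition step_code : cmd :=
  Seq (block_code choice_block) (Seq (Choose 8 7) (block_code descend_block)).

Definition query_code : cmd :=
  Seq (block_code init_block) (Seq (While 3 step_code) (block_code leaf_block)).

Definition step_cost : nat := block_cost choice_block + (1 + block_cost descend_block).

Section Tables.
Context (W Len : nat) (G : nat -> nat -> nat) (Bd : nat).
Hypotheses (W0 : 0 < W) (Bd_le : 4 * (Bd * Bd) <= 2 ^ W).
Hypotheses (Len_le : 32 * Len <= Bd) (Len0 : 0 < Len) (W_le : W <= Bd).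

(** Reduction modulo [2^W] bounds the entries for every [G]; lookups are claimed correct only where
    [G] is below [2^W]. *)
Definition table : seq nat :=
  mkseq (fun n => G (n %% 32) (n %/ 32) %% 2 ^ W) (32 * Len).

Context (n L : nat).
Hypothesis ltn : n < 2 ^ L.

Local Notation ev := (expr_eval W table (bits_of n L)).

Lemma Bd_ltW : 4 * Bd <= 2 ^ W /\ 32 <= Bd.
Proof. by split; nia. Qed.

Lemma nth_table f k : f < 32 -> k < Len -> nth 0 table (f + 32 * k) = G f k %% 2 ^ W.
Proof.
move=> hf hk; rewrite nth_mkseq; last by lia.
have -> : (f + 32 * k) %% 32 = f by rewrite addnC mulnC modnMDl modn_small.
by have -> : (f + 32 * k) %/ 32 = k by rewrite addnC mulnC divnMDl // divn_small ?addn0.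
Qed.

Lemma eval_add r e1 e2 x y : ev r e1 = x -> ev r e2 = y -> x + y < 2 ^ W ->
  ev r (Bin Add e1 e2) = x + y.
Proof. by move=> /= -> -> h; rewrite modn_small. Qed.

Lemma eval_mul r e1 e2 x y : ev r e1 = x -> ev r e2 = y -> x * y < 2 ^ W ->
  ev r (Bin Mul e1 e2) = x * y.
Proof. by move=> /= -> -> h; rewrite modn_small. Qed.

Lemma eval_sub r e1 e2 x y : ev r e1 = x -> ev r e2 = y -> y <= x -> x < 2 ^ W ->
  ev r (Bin Defs.Sub e1 e2) = x - y.
Proof.
move=> /= -> -> h hx; rewrite -addnBA // modnDl modn_small //.
by apply: leq_ltn_trans hx; apply: leq_subr.
Qed.

Lemma eval_div r e1 e2 x y : ev r e1 = x -> ev r e2 = y ->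
  ev r (Bin Div e1 e2) = x %/ y.
Proof. by move=> <- <-. Qed.

Lemma eval_mod r e1 e2 x y : ev r e1 = x -> ev r e2 = y ->
  ev r (Bin Mod e1 e2) = x %% y.
Proof. by move=> <- <-. Qed.

Lemma eval_lt r e1 e2 x y : ev r e1 = x -> ev r e2 = y ->
  ev r (Bin Lt e1 e2) = (x < y).
Proof. by move=> <- <-. Qed.

Lemma eval_num r k : k < 2 ^ W -> ev r (Imm k) = k.
Proof. by move=> h /=; rewrite modn_small. Qed.

Lemma eval_header r f : f < 32 -> G f 0 < 2 ^ W -> ev r (header f) = G f 0.
Proof.
move=> hf h; have [h1 h2] := Bd_ltW.
rewrite /header /= [f %% _]modn_small; last by lia.
by have := nth_table hf Len0; rewrite muln0 addn0 => ->; rewrite modn_small.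
Qed.

Lemma eval_lookup r f e k : f < 32 -> k < Len -> ev r e = k -> G f k < 2 ^ W ->
  ev r (lookup f e) = G f k.
Proof.
move=> hf hk he h; have [h1 h2] := Bd_ltW.
have ea : ev r (Bin Add (Imm f) (Bin Mul (Imm 32) e)) = f + 32 * k.
  apply: eval_add; [apply: eval_num|apply: eval_mul he _; first apply: eval_num|]; lia.
by rewrite /lookup; move: ea => /= ->; rewrite nth_table // modn_small.
Qed.

Hypothesis header_W : G 1 0 = W.

(** As [M <= W], two consecutive words contain the bits. At a multiple of [W] the second word is
    shifted by [W] and vanishes modulo [2^W], so no case distinction arises. *)
Lemma eval_bits r e a M : r 4 = a -> a <= 2 * Bd -> ev r e = 2 ^ M -> M <= W ->
  ev r (bits e) = readbits n a (2 ^ M).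
Proof.
move=> ha aB he MW; have [h1 h2] := Bd_ltW.
have hW : ev r (header 1) = W by rewrite eval_header ?header_W //; lia.
have haW : a %% W < W by rewrite ltn_pmod.
have hdiv : a %/ W <= a by apply: leq_div.
have e0 : ev r (Bin Div (Reg 4) (header 1)) = a %/ W by apply: eval_div.
have em : ev r (Bin Mod (Reg 4) (header 1)) = a %% W by apply: eval_mod.
have e1 : ev r (Bin Add (Bin Div (Reg 4) (header 1)) (Imm 1)) = (a %/ W).+1.
  have -> : (a %/ W).+1 = a %/ W + 1 by rewrite addn1.
  by apply: eval_add => //; [apply: eval_num; lia|lia].
have e2 : ev r (Bin Defs.Sub (header 1) (Bin Mod (Reg 4) (header 1))) = W - a %% W.
  by apply: eval_sub => //; lia.
rewrite /bits; transitivity ((data_word W (bits_of n L) (a %/ W) %/ 2 ^ (a %% W) +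
    (data_word W (bits_of n L) (a %/ W).+1 * 2 ^ (W - a %% W)) %% 2 ^ W) %% 2 ^ W %% 2 ^ M).
  by rewrite -e2 -e1 -em -e0 -he.
rewrite !data_word_bits_of //.
rewrite [RHS]/readbits -[RHS](modn_pow2 _ MW); congr (_ %% _).
rewrite modnDmr -modnDmr /readbits modnMml modnDmr mulSn [W + _]addnC expnD divnMA.
have -> : n %/ 2 ^ a = (n %/ 2 ^ (a %/ W * W)) %/ 2 ^ (a %% W).
  by rewrite -divnMA -expnD -divn_eq.
set m := n %/ 2 ^ (_ * W); set q := a %% W in haW *.
congr (_ %% _); rewrite [in RHS](divn_eq m (2 ^ W)).
have -> : m %/ 2 ^ W * 2 ^ W = m %/ 2 ^ W * 2 ^ (W - q) * 2 ^ q.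
  by rewrite -mulnA -expnD subnK // ltnW.
by rewrite divnMDl ?expn_gt0 // addnC.
Qed.

End Tables.

(** * Codes of labels *)

Lemma digits_lt (F : nat -> nat) q n : (forall i, i < n -> F i < q) ->
  \sum_(i < n) F i * q ^ i < q ^ n.
Proof.
elim: n => [|n IH] h; first by rewrite big_ord0.
rewrite big_ord_recr /= expnS.
have h1 := IH (fun i hi => h i (ltnW hi)); have h2 := h n (ltnSn n).
apply: leq_trans (_ : (F n).+1 * q ^ n <= _); last by rewrite leq_mul2r h2 orbT.
by rewrite mulSn ltn_add2r.
Qed.

Lemma digits_inj (F F' : nat -> nat) q n :
  (forall i, i < n -> F i < q) -> (forall i, i < n -> F' i < q) ->
  \sum_(i < n) F i * q ^ i = \sum_(i < n) F' i * q ^ i ->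
  forall i, i < n -> F i = F' i.
Proof.
elim: n => [|n IH] h h' //; rewrite !big_ord_recr /= => e i hi.
have l1 := digits_lt (fun i hi => h i (ltnW hi)).
have l2 := digits_lt (fun i hi => h' i (ltnW hi)).
move: e l1 l2; set S := \sum_(i < n) F i * _; set S' := \sum_(i < n) F' i * _.
move=> e l1 l2; have q0 : 0 < q ^ n by lia.
have en : F n = F' n.
  by have := congr1 (fun x => x %/ q ^ n) e; rewrite !(addnC _ (_ * q ^ n)) !divnMDl //
     !(divn_small (_ : _ < q ^ n)) // !addn0.
have eS : S = S' by move: e; rewrite en; lia.
move: hi; rewrite ltnS leq_eqVlt => /orP [/eqP -> //|hi].
by apply: IH hi => // j hj; [apply: h|apply: h']; apply: ltnW.
Qed.

Lemma lex_ltn a b c d n : a < n -> b < n -> c <> d ->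
  (c * n + a < d * n + b) = (c < d).
Proof.
move=> an bn ne; case: (ltngtP c d) => // h.
  have := leq_mul h (leqnn n); rewrite mulSn; lia.
by have := leq_mul h (leqnn n); rewrite mulSn; lia.
Qed.

Lemma label_code_lt (Phi Phi2 : finType) (l : Phi * Phi2) :
  label_code l < #|Phi| * #|Phi2|.
Proof.
apply: leq_trans (_ : (enum_rank l.1).+1 * #|Phi2| <= _); last first.
  by rewrite leq_mul2r ltn_ord orbT.
by rewrite /label_code mulSn addnC ltn_add2r ltn_ord.
Qed.

Lemma label_code_inj (Phi Phi2 : finType) : injective (@label_code Phi Phi2).
Proof.
move=> [a b] [a' b']; rewrite /label_code /= => e.
have h := ltn_ord (enum_rank b); have h' := ltn_ord (enum_rank b').
have p0 : 0 < #|Phi2| by apply: leq_ltn_trans h.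
have e1 : enum_rank a = enum_rank a' :> nat.
  by have := congr1 (fun x => x %/ #|Phi2|) e; rewrite !divnMDl // !divn_small // !addn0.
have e2 : enum_rank b = enum_rank b' :> nat by move: e; rewrite e1 => /addnI.
by congr (_, _); apply: enum_rank_inj; apply: val_inj.
Qed.

Section Pack.
Context (Phi Phi2 : finType) (B : nat).

Let digit (v : B.-tuple (Phi * Phi2)) (i : nat) : nat :=
  nth 0 [seq label_code l | l <- v] i.

Let digitE v (i : 'I_B) : digit v i = label_code (tnth v i).
Proof.
by rewrite /digit (nth_map (tnth v i)) ?size_tuple // -tnth_nth.
Qed.

Let digit_lt v i : i < B -> digit v i < #|Phi| * #|Phi2|.
Proof. by move=> h; rewrite -[i]/(val (Ordinal h)) digitE label_code_lt. Qed.

Let packE v : pack v = \sum_(i < B) digit v i * (#|Phi| * #|Phi2|) ^ i.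
Proof. by apply: eq_bigr => i _; rewrite digitE. Qed.

Lemma pack_lt (v : B.-tuple (Phi * Phi2)) : pack v < (#|Phi| * #|Phi2|) ^ B.
Proof. by rewrite packE; apply: digits_lt => i; apply: digit_lt. Qed.

Lemma pack_inj : injective (@pack Phi Phi2 B).
Proof.
move=> v v'; rewrite !packE => e; apply: eq_from_tnth => i.
apply: label_code_inj; rewrite -!digitE.
by apply: digits_inj e _ (ltn_ord i) => j; apply: digit_lt.
Qed.

End Pack.

(** * Running the query program *)

Section Run.
Context (B w t : nat) (A Phi Phi2 : finType) (sz : A -> nat) (f : A -> Phi).
Context (decompose : A -> Phi2 * B.-tuple A) (join : Phi2 * B.-tuple A -> A).
Context (f' : Phi2 * B.-tuple Phi -> Phi).
Hypothesis B0 : 0 < B.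
Hypothesis f_sz : forall X Y : A, f X = f Y -> sz X = sz Y.
Hypothesis decomposeK : forall (be : Phi2) (Xs : B.-tuple A),
  calF f decompose (be, map_tuple f Xs) -> decompose (join (be, Xs)) = (be, Xs).
Hypothesis f'P : forall X : A, f X = f' (profile f decompose X).
Hypothesis sz_part : forall X i, 2 * sz (part decompose X i) <= sz X.

Local Notation Lb := (Phi * Phi2)%type.
Local Notation nl := (#|Phi| * #|Phi2|).
Local Notation child := (part decompose).

Definition lab (X : A) : Lb := (f X, gval decompose X).

Definition phisize (al : Phi) : nat :=
  if [pick X | f X == al] is Some X then sz X else 0.

Lemma phisizeE X : phisize (f X) = sz X.
Proof.
rewrite /phisize; case: pickP => [Y /eqP|/(_ X)]; last by rewrite eqxx.
exact: f_sz.
Qed.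

Definition inner (l : Lb) : bool := 1 < phisize l.1.

Lemma innerE X : inner (lab X) = (1 < sz X).
Proof. by rewrite /inner phisizeE. Qed.

Definition rk (l : Lb) : nat := #|[set al | phisize al < phisize l.1]|.

Lemma rk_le l : rk l <= #|Phi|.
Proof. exact: max_card. Qed.

Lemma rk_part X i : inner (lab X) -> rk (lab (child X i)) < rk (lab X).
Proof.
rewrite innerE => h; have hc := sz_part X i.
apply: proper_card; apply/properP; split.
  by apply/subsetP => al; rewrite !inE /= !phisizeE; lia.
by exists (f (child X i)); rewrite !inE /= !phisizeE ?ltnn //; lia.
Qed.

(** Objects of size 0 with one label share their spill: a leaf of size 0 holds only the label, so
    the tree does not tell them apart. *)
Definition leafuniv (l : Lb) : nat :=
  if phisize l.1 == 1 then #|[set X | lab X == l]| else 1.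

Definition leafspill (X : A) : nat :=
  if sz X == 1 then #|[set Y | (lab Y == lab X) && (enum_rank Y < enum_rank X)]|
  else 0.

Lemma leafspill_lt X : leafspill X < leafuniv (lab X).
Proof.
rewrite /leafspill /leafuniv phisizeE; case: eqP => // _.
apply: proper_card; apply/properP; split.
  by apply/subsetP => Y; rewrite !inE => /andP [].
by exists X; rewrite !inE ?eqxx ?ltnn.
Qed.

(** Each choice of parts with the same labels is joined to a different object: [decomposeK] recovers
    the parts and [g], and [f'P] then gives the same value of [f]. *)
Lemma labcard_part X : inner (lab X) ->
  \prod_(i < B) labcard lab (lab (child X i)) <=
    #|[set Y | (lab Y == lab X) && (childlabs lab child Y == childlabs lab child X)]|.
Proof.
move=> hi; set RHS := #|_|.
have -> : \prod_(i < B) labcard lab (lab (child X i)) =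
    #|family (fun i : 'I_B => [set Y | lab Y == lab (child X i)])|.
  by rewrite card_family foldrE big_map -big_enum /=.
pose h (F : {ffun 'I_B -> A}) := join (gval decompose X, [tuple F i | i < B]).
have dec F : F \in family (fun i : 'I_B => [set Y | lab Y == lab (child X i)]) ->
    decompose (h F) = (gval decompose X, [tuple F i | i < B]).
  move=> /familyP hF; apply: decomposeK; exists X; rewrite /profile.
  congr (_, _); apply: eq_from_tnth => i; rewrite tnth_map !tnth_mktuple.
  by have := hF i; rewrite inE => /eqP [].
have hinj : {in family (fun i : 'I_B => [set Y | lab Y == lab (child X i)]) &, injective h}.
  move=> F F' hF hF' e; have := dec F hF; rewrite e dec // => -[] e'.
  apply/ffunP => i; have : tnth [tuple F' i | i < B] i = tnth [tuple F i | i < B] i.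
    by congr tnth; apply: val_inj.
  by rewrite !tnth_mktuple.
rewrite -(card_in_imset hinj); apply: subset_leq_card; apply/subsetP => Y.
move=> /imsetP [F hF ->]; have hd := dec F hF.
have hp i : child (h F) i = F i by rewrite /part hd tnth_mktuple.
have hl i : lab (F i) = lab (child X i).
  by move/familyP: hF => /(_ i); rewrite inE => /eqP.
rewrite inE; apply/andP; split; apply/eqP; last first.
  by apply: eq_from_tnth => i; rewrite !tnth_mktuple hp hl.
have hg : gval decompose (h F) = gval decompose X by rewrite /gval hd.
rewrite /lab hg; congr (_, _); rewrite !f'P; congr f'; rewrite /profile hg.
congr (_, _); apply: eq_from_tnth => i; rewrite !tnth_mktuple hp.
by have [] := hl i.
Qed.

(** * Choice of the parameters *)

Hypotheses (t4 : 4 <= t) (nl_le : nl <= 2 ^ t) (B_le : B <= 2 ^ t).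
Hypothesis pack_le : nl ^ B <= 2 ^ t.
Hypothesis Phi_le : 6 * #|Phi| * 2 ^ w <= 2 ^ t.
Hypothesis size1_le : #|size1 sz| <= 2 ^ t.
Hypothesis numN_le : forall X, labcard lab (lab X) <= 2 ^ (2 ^ w).

Local Notation E := (2 ^ t).
Local Notation E2 := (2 ^ (2 * t)).
Local Notation Th := (4 * E * E2).
Local Notation U := (4 * E2).
Local Notation W0 := (5 * t + 4).
Local Notation W := (20 * t).
Local Notation Bd := (2 ^ (8 * t)).

Definition lay : Lb -> nat * nat := layout lab child inner rk leafuniv E2 Th U W0.
Local Notation tlay := (tuple_layout E2 Th lay).

Lemma card_tuples : #|{: B.-tuple Lb}| = nl ^ B.
Proof. by rewrite card_tuple card_prod. Qed.

Let E0 : 0 < E. Proof. by rewrite expn_gt0. Qed.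

Let hE2 : E * #|{: B.-tuple Lb}| <= E2.
Proof. by rewrite card_tuples mul2n -addnn expnD leq_mul2l pack_le orbT. Qed.

Let hW0 : 4 * E2 * Th <= 2 ^ W0.
Proof.
have -> : 2 ^ W0 = 16 * (E2 * (E * E2)).
  by rewrite -!expnD -[16]/(2 ^ 4) -expnD; congr (2 ^ _); lia.
by apply: eq_leq; ring.
Qed.

Let leafuniv_le X : ~~ inner (lab X) ->
  leafuniv (lab X) <= labcard lab (lab X) /\ leafuniv (lab X) <= U.
Proof.
move=> _; rewrite /leafuniv phisizeE; case: eqP => [s1|_]; last first.
  split; last by rewrite muln_gt0 expn_gt0.
  by apply/card_gt0P; exists X; rewrite inE.
split=> //; apply: leq_trans (_ : #|size1 sz| <= _).
  apply: subset_leq_card; apply/subsetP => Y; rewrite !inE => /eqP [hf _].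
  by rewrite (f_sz hf) s1.
apply: leq_trans size1_le _; apply: leq_trans (_ : E2 <= _); last by lia.
by rewrite leq_exp2l //; lia.
Qed.

Lemma lay_ok X : layout_ok lab child inner rk leafuniv E E2 Th U W0 X.
Proof.
apply: (layout_okP (leafspill := leafspill)) => //.
- exact: rk_part.
- by move=> Y _; apply: leafspill_lt.
- exact: labcard_part.
Qed.

(** The exponent is at most [3 * #|Phi| * 2^w], and twice that is at most [E] by [Phi_le], so all
    losses together stay within a factor 2. *)
Lemma lay_card X : (lay (lab X)).2 * 2 ^ (lay (lab X)).1 <= 2 * labcard lab (lab X).
Proof.
have [_ _ _ hs] := lay_ok X; apply: slack_le_double hs.
apply: leq_trans Phi_le.
have h1 := rk_le (lab X).
have h2 : trunc_log 2 (labcard lab (lab X)) <= 2 ^ w.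
  rewrite -[X in _ <= X](@trunc_expnK 2) //; apply: leq_trunc_log; exact: numN_le.
by have := leq_mul h1 h2; lia.
Qed.

(** [2^M <= 2 N <= 2^(2^w + 1)], so bit addresses fit into a word. *)
Lemma lay_mem_le X : (lay (lab X)).1 <= 2 ^ t.
Proof.
have [K0 _ _ _] := lay_ok X; have hc := lay_card X.
have h : 2 ^ (lay (lab X)).1 <= 2 ^ (2 ^ w).+1.
  rewrite expnS; apply: leq_trans (_ : 2 * labcard lab (lab X) <= _); last first.
    by rewrite leq_mul2l numN_le.
  by apply: leq_trans hc; rewrite leq_pmull.
rewrite leq_exp2l // in h; apply: leq_trans h _; apply: leq_trans Phi_le.
have : 0 < #|Phi| by apply/card_gt0P; exists (f X).
have : 0 < 2 ^ w by rewrite expn_gt0.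
by nia.
Qed.

Local Notation spec := (alias_spec lab child inner rk leafuniv E2 Th U W0).

Lemma alias_family : exists alias : Lb -> nat -> cell (B.-tuple Lb),
  forall X, inner (lab X) -> spec (lab X) (alias (lab X)).
Proof.
have ex l : exists tab, forall X, lab X = l -> inner l -> spec l tab.
  case: (pickP [pred X | (lab X == l) && inner l]) => [X /andP [/eqP <- hi]|none].
    have [tab h] : exists tab, spec (lab X) tab.
      apply: (alias_exists (leafspill := leafspill) (E := E)) => //.
      - exact: rk_part.
      - by move=> Y _; apply: leafspill_lt.
      - exact: labcard_part.
    by exists tab.
  (* A dummy for labels of no inner object. *)
  exists (fun=> Cell 0 (fun=> nseq_tuple B l) (fun=> 0)) => X e hi.
  by have := none X; rewrite /= e eqxx hi.
have [alias h] := boolp.choice ex.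
by exists alias => X; apply: h.
Qed.

Definition spill_bits (l : Lb) : nat := up_log 2 (lay l).2.

Lemma spill_bits_le X : 2 ^ spill_bits (lab X) <= 2 * (lay (lab X)).2.
Proof.
have [K0 _ _ _] := lay_ok X; rewrite /spill_bits.
case: (ltnP 1 (lay (lab X)).2) => K1.
  have /andP [h _] := up_log_bounds (ltnSn 1) K1.
  by rewrite -[X in 2 ^ X]prednK ?up_log_gt0 // expnS leq_mul2l ltnW.
have -> : (lay (lab X)).2 = 1 by apply/eqP; rewrite eqn_leq K1 K0.
by rewrite up_log1.
Qed.

Definition store_bits (X : A) : nat := (lay (lab X)).1 + spill_bits (lab X).

Lemma store_bits_le X : 2 ^ store_bits X <= 2 ^ 2 * labcard lab (lab X).
Proof.
rewrite /store_bits expnD mulnC; apply: leq_trans (leq_mul (spill_bits_le X) (leqnn _)) _.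
by rewrite -mulnA -[2 ^ 2]/(2 * 2) -mulnA leq_mul2l lay_card.
Qed.

Context (alias : Lb -> nat -> cell (B.-tuple Lb)).
Hypothesis aliasP : forall X, inner (lab X) -> spec (lab X) (alias (lab X)).

(** * Contents of the tables *)

Local Notation quant := (quantum lab child inner rk leafuniv E2 Th U W0).
Local Notation extra := (extra_bits lab child inner rk leafuniv E2 Th U W0).
Local Notation clink := (child_link lab child inner rk leafuniv E2 Th U W0).
Local Notation clabs := (childlabs lab child).
Local Notation choose_child := (select lab child inner rk leafuniv E2 Th U W0 alias).
Local Notation enc := (encodes lab child inner rk leafuniv leafspill E2 Th U W0 alias).
Local Notation tspill := (tuple_spill lab child inner rk leafuniv E2 Th U W0).

(** Ordering the objects of size 1 by label and then by rank puts those with one label into a block;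
    this is its start, and the spill is the position in it. So one table with [#|size1 sz|] entries
    serves all labels. *)
Definition leafbase (l : Lb) : nat :=
  if phisize l.1 == 1 then #|[set Y in size1 sz | label_code (lab Y) < label_code l]|
  else 0.

Definition leafpos (X : A) : nat := leafbase (lab X) + leafspill X.

Definition leafentry (k : nat) : nat :=
  if [pick X in size1 sz | leafpos X == k] is Some X
  then (index X (enum (size1 sz))).+1 else 0.

Definition label_entry (F : Lb -> nat) (k : nat) : nat :=
  if [pick l | label_code l == k] is Some l then F l else 0.

Definition tuple_entry (F : B.-tuple Lb -> nat) (k : nat) : nat :=
  if [pick v | pack v == k] is Some v then F v else 0.

Definition cell_entry (F : Lb -> cell (B.-tuple Lb) -> nat) (k : nat) : nat :=
  label_entry (fun l => F l (alias l (k %/ nl))) (k %% nl).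

Definition item_entry (F : Lb -> cell (B.-tuple Lb) -> bool -> nat) (k : nat) : nat :=
  cell_entry (fun l ce => F l ce (odd k)) k./2.

Definition link_entry (F : link -> nat) (k : nat) : nat :=
  tuple_entry (fun v => F (clink v (k %% B))) (k %/ B).

(** Fields 0 to 3 are constants for the program; 4 to 9 are indexed by labels, 10 by cell and label,
    11 to 15 also by the half of the cell, 16 to 28 by tuple and child, 29 by the position of an
    object of size 1. *)
Definition entries (fld k : nat) : nat :=
  match fld with
  | 0 => #|Phi2| | 1 => W | 2 => nl | 3 => B
  | 4 => label_entry (fun l => inner l) k
  | 5 => label_entry (fun l => (lay l).1) k
  | 6 => label_entry (fun l => 2 ^ spill_bits l) k
  | 7 => label_entry quant k
  | 8 => label_entry (fun l => phisize l.1 == 1) k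
  | 9 => label_entry leafbase k
  | 10 => cell_entry (fun l ce => threshold ce) k
  | 11 => item_entry (fun l ce b => pack (item ce b)) k
  | 12 => item_entry (fun l ce b => base ce b) k
  | 13 => item_entry (fun l ce b => if b then 0 else threshold ce) k
  | 14 => item_entry (fun l ce b => 2 ^ extra l (item ce b)) k
  | 15 => item_entry (fun l ce b => (tlay (item ce b)).1) k
  | 16 => link_entry (fun x => soff (glow (lgroup x))) k
  | 17 => link_entry (fun x => smod (glow (lgroup x))) k
  | 18 => link_entry (fun x => sflag (glow (lgroup x))) k
  | 19 => link_entry (fun x => gdiv (lgroup x)) k
  | 20 => link_entry (fun x => gmul (lgroup x)) k
  | 21 => link_entry (fun x => soff (ghigh (lgroup x))) k
  | 22 => link_entry (fun x => smod (ghigh (lgroup x))) k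
  | 23 => link_entry (fun x => sflag (ghigh (lgroup x))) k
  | 24 => link_entry (fun x => gmod (lgroup x)) k
  | 25 => link_entry lradix k
  | 26 => link_entry luniv k
  | 27 => link_entry loff k
  | 28 => tuple_entry (fun v => nth 0 [seq label_code l | l <- v] (k %% B)) (k %/ B)
  | 29 => leafentry k
  | _ => 0
  end.

(** A label has fewer than [2 * nl^B] cells of two halves each, whence [4 * nl^B * nl]; the pairs of
    tuple and child need [nl^B * B]. The sum bounds the length of every field. *)
Definition table_len : nat := #|size1 sz| + 4 * (nl ^ B * (nl + B)) + 1.

Local Notation Tb := (table W table_len entries).

Lemma label_entryE F l : label_entry F (label_code l) = F l.
Proof.
rewrite /label_entry; case: pickP => [l' /eqP /label_code_inj -> //|/(_ l)].
by rewrite eqxx.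
Qed.

Lemma tuple_entryE F v : tuple_entry F (pack v) = F v.
Proof.
rewrite /tuple_entry; case: pickP => [v' /eqP /pack_inj -> //|/(_ v)].
by rewrite eqxx.
Qed.

Lemma cell_entryE F l c : cell_entry F (c * nl + label_code l) = F l (alias l c).
Proof.
have lt := label_code_lt l.
rewrite /cell_entry modnMDl modn_small // label_entryE divnMDl; last by lia.
by rewrite divn_small // addn0.
Qed.

Lemma item_entryE F l c (b : bool) :
  item_entry F ((c * nl + label_code l) * 2 + b) = F l (alias l c) b.
Proof.
rewrite /item_entry; set k := c * nl + _.
have -> : (k * 2 + b)./2 = k by rewrite muln2 addnC half_bit_double.
by rewrite cell_entryE oddD muln2 odd_double oddb.
Qed.

Lemma link_entryE F (v : B.-tuple Lb) (i : 'I_B) : link_entry F (pack v * B + i) = F (clink v i).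
Proof.
rewrite /link_entry modnMDl modn_small // divnMDl // divn_small //.
by rewrite addn0 tuple_entryE.
Qed.

Lemma child_entryE (v : B.-tuple Lb) (i : 'I_B) :
  entries 28 (pack v * B + i) = label_code (tnth v i).
Proof.
rewrite /= modnMDl modn_small // divnMDl // divn_small // addn0 tuple_entryE.
by rewrite (nth_map (tnth v i)) ?size_tuple // -tnth_nth.
Qed.

(** The sizes of the earlier blocks and the rank in the block add up to the number of smaller keys
    in lexicographic order; hence positions are distinct and below [#|size1 sz|]. *)
Lemma leafpos_key X : sz X = 1 -> leafpos X =
  #|[set Y in size1 sz | label_code (lab Y) * #|A| + enum_rank Y <
                         label_code (lab X) * #|A| + enum_rank X]|.
Proof.
move=> s1; rewrite /leafpos /leafbase /leafspill phisizeE s1 eqxx.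
rewrite -cardsUI [X in _ + X](_ : _ = 0) ?addn0; last first.
  apply/eqP; rewrite cards_eq0; apply/eqP/setP => Y; rewrite !inE.
  by case: (lab Y =P lab X) => [->|]; rewrite ?ltnn ?andbF.
apply: eq_card => Y; rewrite !inE.
have hY := ltn_ord (enum_rank Y); have hX := ltn_ord (enum_rank X).
case: (lab Y =P lab X) => [e|ne].
  rewrite e ltnn andbF ltn_add2l; case: e => hf _.
  by rewrite (f_sz hf) s1 eqxx.
rewrite orbF; congr (_ && _).
have ne' : label_code (lab Y) <> label_code (lab X) by move=> /label_code_inj.
exact/esym/lex_ltn.
Qed.

Lemma leafentryE X : sz X = 1 ->
  leafpos X < #|size1 sz| /\ leafentry (leafpos X) = (index X (enum (size1 sz))).+1.
Proof.
move=> s1; have hX : X \in size1 sz by rewrite inE s1.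
pose key Y := label_code (lab Y) * #|A| + enum_rank Y.
have mono Y Z : Y \in size1 sz -> Z \in size1 sz -> key Y < key Z -> leafpos Y < leafpos Z.
  rewrite !inE => /eqP hY /eqP hZ hk; rewrite !leafpos_key // -!/(key _).
  apply: proper_card; apply/properP; split.
    apply/subsetP => V; rewrite !inE => /andP [-> /= h].
    exact: ltn_trans h hk.
  by exists Y; rewrite !inE hY ?eqxx //= -!/(key _) ltnn.
split.
  rewrite leafpos_key //; apply: proper_card; apply/properP; split.
    by apply/subsetP => V; rewrite !inE => /andP [].
  by exists X; rewrite !inE s1 ?ltnn ?andbF.
rewrite /leafentry; case: pickP => [Y /andP [hY /eqP e]|/(_ X)]; last first.
  by rewrite hX eqxx.
have ek : key Y = key X.
  by case: (ltngtP (key Y) (key X)) => // /mono h;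
     [have := h hY hX|have := h hX hY]; rewrite e ltnn.
suff -> : Y = X by [].
apply: enum_rank_inj; apply: val_inj; rewrite /=.
have lY := ltn_ord (enum_rank Y); have lX := ltn_ord (enum_rank X).
by have := congr1 (modn^~ #|A|) ek; rewrite /key !modnMDl !modn_small.
Qed.

Let Bd_sq : 4 * (Bd * Bd) <= 2 ^ W.
Proof. by rewrite -[4]/(2 ^ 2) -!expnD leq_exp2l //; lia. Qed.

Let pow_le_Bd k : k <= 8 * t -> 2 ^ k <= Bd.
Proof. by move=> h; rewrite leq_exp2l. Qed.

Let small_le_Bd k : k <= 2 ^ t -> k <= Bd.
Proof. by move=> h; apply: leq_trans h _; apply: pow_le_Bd; lia. Qed.

Let Len_Bd : 32 * table_len <= Bd.
Proof.
have h1 : nl ^ B * (nl + B) <= 2 ^ (2 * t).+1.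
  rewrite expnS mul2n -addnn mul2n -addnn expnD -mulnDr.
  by apply: leq_mul => //; apply: leq_add.
have h2 : 2 ^ t <= 2 ^ (2 * t).+1 by rewrite leq_exp2l //; lia.
have h3 : 32 * (8 * 2 ^ (2 * t).+1) <= Bd.
  by rewrite -[32]/(2 ^ 5) -[8]/(2 ^ 3) -!expnD; apply: pow_le_Bd; lia.
have h4 : 0 < 2 ^ (2 * t).+1 by rewrite expn_gt0.
by rewrite /table_len; lia.
Qed.

Let W_gt0 : 0 < W. Proof. by lia. Qed.

Let Len_gt0 : 0 < table_len. Proof. by rewrite /table_len addn1. Qed.

Let W_Bd : W <= Bd.
Proof.
have h1 : t < 2 ^ t by apply: ltn_expl.
have h2 : 2 ^ 5 * 2 ^ t <= Bd by rewrite -expnD; apply: pow_le_Bd; lia.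
by lia.
Qed.

Let U_Bd : 2 * U <= Bd.
Proof. by rewrite mulnA -[2 * 4]/(2 ^ 3) -expnD; apply: pow_le_Bd; lia. Qed.

Let H_Bd : 4 * Th * U <= Bd.
Proof.
have -> : 4 * Th * U = 64 * (E * (E2 * E2)) by ring.
by rewrite -[64]/(2 ^ 6) -!expnD; apply: pow_le_Bd; lia.
Qed.

Let Bd_lt : 4 * Bd <= 2 ^ W /\ 32 <= Bd.
Proof.
have h : 32 <= Bd by move: Len_Bd Len_gt0; lia.
by split=> //; apply: leq_trans Bd_sq; rewrite leq_mul2l leq_pmulr //; apply: leq_trans h.
Qed.

Let Bd_poly : 2 * (Bd * Bd) + 2 * Bd < 2 ^ W.
Proof.
apply: leq_trans Bd_sq; have [_] := Bd_lt; move: Bd => b h.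
by have := leq_mul h (leqnn b); lia.
Qed.

Let nl_gt0 (X : A) : 0 < nl.
Proof. by apply: leq_ltn_trans (label_code_lt (lab X)). Qed.

Let label_len (l : Lb) : label_code l < table_len.
Proof.
apply: leq_trans (label_code_lt l) _; rewrite /table_len.
have n0 : 0 < nl by apply: leq_ltn_trans (label_code_lt l).
have : 0 < nl ^ B by rewrite expn_gt0 n0.
by nia.
Qed.

Lemma quantum_le X : quant (lab X) <= U.
Proof.
have [K0 KU _ _] := lay_ok X; rewrite /quantum geq_max.
rewrite (leq_trans K0 KU) /=; apply: leq_trans KU; exact: leq_div.
Qed.

Lemma cell_index_lt X x : x < (lay (lab X)).2 -> x %/ quant (lab X) < 2 * nl ^ B.
Proof.
move=> hx; rewrite /quantum /ncells card_tuples -/lay.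
have V0 : 0 < nl ^ B by rewrite expn_gt0 nl_gt0.
rewrite ltn_divLR ?leq_max //; apply: leq_trans hx _.
set K := (lay _).2; have := ltn_ceil K V0; set q := K %/ _ => h.
by case: (leqP 1 q) => hq; nia.
Qed.

Lemma tuple_mem_le X : inner (lab X) -> (tlay (clabs X)).1 <= (lay (lab X)).1.
Proof.
move=> hi; rewrite /lay layout_inner //; last exact: rk_part.
exact/leq_nmem/valid_childlabs.
Qed.

Lemma child_link_fits X (i : 'I_B) : inner (lab X) ->
  link_fits (tlay (clabs X)).1 (4 * Th * U) (clink (clabs X) i) /\
  loff (clink (clabs X) i) <= (tlay (clabs X)).1.
Proof.
move=> hi; have EE2 : E <= E2 by rewrite leq_exp2l //; lia.
have U0 : 0 < U by rewrite muln_gt0 expn_gt0.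
have C4 : 0 < 1 <= 4 * E2 by rewrite /= muln_gt0 expn_gt0.
have T1 : 1 < Th.
  have : 0 < E * E2 by rewrite muln_gt0 !expn_gt0.
  by lia.
have hall : all (fun x => x.2 <= U) [seq lay l | l <- clabs X].
  by apply/allP => y /mapP [l0 /mapP [j _ ->] ->]; have [] := lay_ok (child X j).
have hi' : i < size [seq lay l | l <- clabs X] by rewrite size_map size_tuple.
have [h1 h2] := links_fits E0 EE2 (leqnn _) U0 (leqnn _) nolink (0, 0) C4 T1 hall hi'.
by split=> //; apply: leq_trans h2; apply: leq_addr.
Qed.

Lemma block_run_cons W' T D r d e x l : expr_eval W' T D r e = x ->
  block_run W' T D r ((d, e) :: l) = block_run W' T D (upd r d x) l.
Proof. by move=> <-. Qed.

Lemma leafentry_le k : leafentry k <= #|size1 sz|.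
Proof.
by rewrite /leafentry; case: pickP => // X /andP [h _]; rewrite cardE index_mem mem_enum.
Qed.

Definition leafobj (X : A) : leafval A Phi Phi2 :=
  (lab X, if sz X == 1 then Some X else None).

Local Notation tree := (abtree_of sz f decompose).

Lemma abtree_leaf X : ~~ inner (lab X) -> tree X = Leaf (leafobj X).
Proof.
by rewrite innerE -leqNgt /abtree_of => h; case: (sz X) (h) => [|k] /= h'; rewrite h.
Qed.

Lemma abtree_fuelE k X : sz X <= k -> abtree_fuel sz f decompose k X = tree X.
Proof.
move: {2}k (leqnn k) => m; elim: m k X => [|m IH] k X hm hk.
  have -> : k = 0 by lia.
  by rewrite /abtree_of; have -> : sz X = 0 by lia.
case: (leqP (sz X) 1) => h1.
  by rewrite /abtree_of; case: k hm hk => [|k] _ _; case: (sz X) (h1) => [|j] /= _;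
     rewrite h1.
case: k hm hk => [|k] hm hk; first by lia.
rewrite /abtree_of; case e: (sz X) => [|j]; first by lia.
rewrite /= leqNgt h1 /=; congr Node; apply/ffunP => i; rewrite !ffunE.
by have hp := sz_part X i; rewrite !IH //; lia.
Qed.

Lemma abtree_inner X : inner (lab X) -> tree X = Node (lab X) [ffun i => tree (child X i)].
Proof.
rewrite innerE => h1; rewrite {1}/abtree_of; case e: (sz X) => [|j]; first by lia.
rewrite /= leqNgt h1 /=; congr Node; apply/ffunP => i; rewrite !ffunE.
by rewrite abtree_fuelE //; have hp := sz_part X i; lia.
Qed.

Lemma root_label_tree X : root_label (tree X) = lab X.
Proof.
by case: (boolP (inner (lab X))) => h; [rewrite abtree_inner|rewrite abtree_leaf].
Qed.

(** * Simulation of the program without overflow *)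

Section Data.
Context (n L : nat) (S Ans : Type) (q : query A Phi Phi2 B S Ans).
Hypothesis nL : n < 2 ^ L.

Local Notation D := (bits_of n L).
Local Notation ev := (expr_eval W Tb D).
Local Notation ask := (ask_query q).

Let ev_lookup fld r e k : fld < 32 -> k < table_len -> ev r e = k ->
  entries fld k <= Bd -> ev r (lookup fld e) = entries fld k.
Proof.
move=> h1 h2 h3 h4.
apply: (eval_lookup W_gt0 Bd_sq Len_Bd Len_gt0 W_Bd nL) => //; lia.
Qed.

Let ev_header fld r : fld < 32 -> entries fld 0 <= Bd ->
  ev r (header fld) = entries fld 0.
Proof.
move=> h1 h4.
apply: (eval_header W_gt0 Bd_sq Len_Bd Len_gt0 W_Bd nL) => //; lia.
Qed.

Let ev_bits r e a M : r 4 = a -> a <= 2 * Bd -> ev r e = 2 ^ M -> 2 ^ M <= Bd ->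
  ev r (bits e) = readbits n a (2 ^ M).
Proof.
move=> h1 h2 h3 h4; apply: (eval_bits W_gt0 Bd_sq Len_Bd Len_gt0 W_Bd nL) => //.
by rewrite -(@leq_exp2l 2) //; lia.
Qed.

Lemma init_run X : block_run W Tb D (init_regs (f X) (gval decompose X)) init_block =
  upd (upd (upd (upd (upd (init_regs (f X) (gval decompose X)) 0 (label_code (lab X)))
    4 (lay (lab X)).1) 1 (readbits n (lay (lab X)).1 (2 ^ spill_bits (lab X))))
    2 0) 3 (inner (lab X)).
Proof.
have [Bd1 Bd2] := Bd_lt.
have lt := label_code_lt (lab X).
have [K0 KU _ _] := lay_ok X.
have hM := small_le_Bd (lay_mem_le X).
have Phi2_le : #|Phi2| <= Bd.
  apply: small_le_Bd; apply: leq_trans nl_le; rewrite leq_pmull //.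
  by apply/card_gt0P; exists (f X).
have lB := small_le_Bd (leq_trans (ltnW lt) nl_le).
have e0 : ev (init_regs (f X) (gval decompose X))
    (Bin Add (Bin Mul (Reg 0) (header 0)) (Reg 1)) = label_code (lab X).
  apply: eval_add => //; last by apply: (leq_ltn_trans lB); lia.
  apply: eval_mul => //; first exact: ev_header.
  apply: (leq_ltn_trans (leq_addr (enum_rank (gval decompose X)) _)).
  by apply: (leq_ltn_trans lB); lia.
have kb_le : 2 ^ spill_bits (lab X) <= Bd.
  apply: leq_trans (spill_bits_le X) _; apply: leq_trans U_Bd.
  by rewrite leq_mul2l.
have e5 (r : regs) : r 0 = label_code (lab X) -> ev r (lookup 5 (Reg 0)) = (lay (lab X)).1.
  by move=> hr; rewrite (ev_lookup (k := label_code (lab X))) //= ?label_entryE.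
have e6 (r : regs) : r 0 = label_code (lab X) -> ev r (lookup 6 (Reg 0)) = 2 ^ spill_bits (lab X).
  by move=> hr; rewrite (ev_lookup (k := label_code (lab X))) //= ?label_entryE.
have e4 (r : regs) : r 0 = label_code (lab X) -> ev r (lookup 4 (Reg 0)) = inner (lab X).
  move=> hr; rewrite (ev_lookup (k := label_code (lab X))) //= ?label_entryE //.
  by apply: leq_trans (leq_b1 _) _; lia.
rewrite /init_block (block_run_cons _ _ e0) (block_run_cons _ _ (e5 _ _)) //.
have eb (r : regs) : r 0 = label_code (lab X) -> r 4 = (lay (lab X)).1 ->
    ev r (bits (lookup 6 (Reg 0))) = readbits n (lay (lab X)).1 (2 ^ spill_bits (lab X)).
  by move=> hr hr4; apply: ev_bits => //; [lia|apply: e6].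
rewrite (block_run_cons _ _ (eb _ _ _)) //.
have en r : ev r (Imm 0) = 0 by apply: eval_num; rewrite expn_gt0.
rewrite (block_run_cons _ _ (en _)).
by rewrite (block_run_cons _ _ (e4 _ _)).
Qed.

Lemma choice_run r Om X a x y :
  inner (lab X) -> x < (lay (lab X)).2 -> a + (lay (lab X)).1 <= Om -> Om <= 2 ^ t ->
  choose_child (lab X) x = (clabs X, y) ->
  r 0 = label_code (lab X) -> r 1 = x -> r 2 = a ->
  let sp := tspill n a (lab X) (clabs X) y in
  let r' := block_run W Tb D r choice_block in
  [/\ sp <= Bd * Bd + Bd, r' 2 = a, r' 6 = sp & r' 7 = pack (clabs X)].
Proof.
move=> hi hx haO hOm hch r0 r1 r2 sp.
have [Bd1 Bd2] := Bd_lt.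
have [aspec _] := aliasP hi.
have hcell := cell_index_lt hx.
have hqU := quantum_le X.
have [K0 KU _ _] := lay_ok X.
move: hch; rewrite /select; set qu := quant (lab X) in hcell hqU *.
set c := x %/ qu in hcell *; set off := x %% qu; set ce := alias (lab X) c.
rewrite /cell_value; set b := cell_low ce off => -[hv hy].
have qu0 : 0 < qu by rewrite leq_max.
have hoff : off < qu by rewrite ltn_pmod.
have hth : threshold ce <= qu by have [] := aspec c b.
have hbase : base ce b <= U by have [_ h] := aspec c b; apply: leq_trans h KU.
have UB : U <= Bd by apply: leq_trans U_Bd; apply: leq_pmull.
have lt := label_code_lt (lab X).
pose k := c * nl + label_code (lab X).
have hk : k * 2 + b < table_len.
  have : k.+1 <= 2 * nl ^ B * nl.
    apply: leq_trans (_ : c.+1 * nl <= _); last by rewrite leq_mul2r hcell orbT.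
    by rewrite /k mulSn addnC ltn_add2r.
  have := leq_b1 b; rewrite /table_len mulnDr; lia.
have hk' : k < table_len by apply: leq_ltn_trans hk; lia.
have kBd : 32 * (k * 2 + b) < Bd by apply: leq_trans Len_Bd; rewrite ltn_mul2l.
have nlB : nl <= Bd by apply: small_le_Bd.
have vmem := leq_trans (tuple_mem_le hi) (lay_mem_le X).
have vB := small_le_Bd vmem.
have xB : 2 ^ extra (lab X) (clabs X) <= Bd.
  apply: pow_le_Bd; rewrite /extra_bits /nbits geq_min; apply/orP; right; lia.
have pB : pack (clabs X) <= Bd.
  by apply: small_le_Bd; apply: leq_trans (ltnW (pack_lt _)) pack_le.
have thB : threshold ce <= Bd := leq_trans hth (leq_trans hqU UB).
have f7 (r' : regs) : r' 0 = label_code (lab X) -> ev r' (lookup 7 (Reg 0)) = qu.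
  move=> hr; rewrite (ev_lookup (k := label_code (lab X))) //= ?label_entryE //; lia.
have f10 (r' : regs) : r' 5 = k -> ev r' (lookup 10 (Reg 5)) = threshold ce.
  by move=> hr; rewrite (ev_lookup (k := k)) //= ?cell_entryE.
have f11 (r' : regs) : r' 5 = k * 2 + b -> ev r' (lookup 11 (Reg 5)) = pack (clabs X).
  by move=> hr; rewrite (ev_lookup (k := k * 2 + b)) //= ?item_entryE -/ce hv.
have f12 (r' : regs) : r' 5 = k * 2 + b -> ev r' (lookup 12 (Reg 5)) = base ce b.
  move=> hr; rewrite (ev_lookup (k := k * 2 + b)) //= ?item_entryE -/ce //; lia.
have f13 (r' : regs) : r' 5 = k * 2 + b ->
    ev r' (lookup 13 (Reg 5)) = if b then 0 else threshold ce.
  by move=> hr; rewrite (ev_lookup (k := k * 2 + b)) //= ?item_entryE -/ce //; case: (b).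
have f14 (r' : regs) : r' 5 = k * 2 + b ->
    ev r' (lookup 14 (Reg 5)) = 2 ^ extra (lab X) (clabs X).
  by move=> hr; rewrite (ev_lookup (k := k * 2 + b)) //= ?item_entryE -/ce hv.
have f15 (r' : regs) : r' 5 = k * 2 + b -> ev r' (lookup 15 (Reg 5)) = (tlay (clabs X)).1.
  by move=> hr; rewrite (ev_lookup (k := k * 2 + b)) //= ?item_entryE -/ce hv.
have h2 r' : ev r' (header 2) = nl by apply: ev_header.
have yB : y <= Bd by rewrite -hy; lia.
have yx := leq_mul yB xB.
have aB : a + (tlay (clabs X)).1 <= 2 * Bd.
  have : a <= Bd by apply: small_le_Bd; lia.
  by lia.
have rdB : readbits n (a + (tlay (clabs X)).1) (2 ^ extra (lab X) (clabs X)) <= Bd.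
  by apply: leq_trans (ltnW (ltn_pmod _ _)) xB; rewrite expn_gt0.
have s1 : ev r (Bin Add (Bin Mul (Bin Div (Reg 1) (lookup 7 (Reg 0))) (header 2)) (Reg 0)) = k.
  apply: eval_add => //; last by rewrite -/k; lia.
  apply: eval_mul; [by apply: eval_div => //; apply: f7|exact: h2|].
  by rewrite -/c; apply: leq_ltn_trans (leq_addr (label_code (lab X)) _) _; rewrite -/k; lia.
have s2 (r' : regs) : r' 0 = label_code (lab X) -> r' 1 = x ->
    ev r' (Bin Mod (Reg 1) (lookup 7 (Reg 0))) = off.
  by move=> h h'; apply: eval_mod; [|apply: f7].
have s3 (r' : regs) : r' 5 = k -> r' 10 = off ->
    ev r' (Bin Add (Bin Mul (Reg 5) (Imm 2)) (Bin Lt (Reg 10) (lookup 10 (Reg 5)))) =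
    k * 2 + b.
  move=> h h'; apply: eval_add; last by lia.
    by apply: eval_mul => //; [apply: eval_num; lia|lia].
  by apply: eval_lt => //; apply: f10.
have s5 (r' : regs) : r' 5 = k * 2 + b -> r' 10 = off ->
    ev r' (Bin Defs.Sub (Bin Add (lookup 12 (Reg 5)) (Reg 10)) (lookup 13 (Reg 5))) = y.
  move=> h h'; rewrite -hy; apply: eval_sub; [|exact: f13| |by lia].
    by apply: eval_add => //; [apply: f12|lia].
  (* In the second half the offset is at least the threshold, so the subtraction does not wrap
     around. *)
  case: ifP => // /negbT; rewrite /b /cell_low -leqNgt => hle.
  exact: leq_trans hle (leq_addl _ _).
have s6 (r' : regs) : r' 5 = k * 2 + b -> r' 2 = a ->
    ev r' (Bin Add (Reg 2) (lookup 15 (Reg 5))) = a + (tlay (clabs X)).1.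
  by move=> h h'; apply: eval_add; [|apply: f15|lia].
have s7 (r' : regs) : r' 5 = k * 2 + b -> r' 10 = y -> r' 4 = a + (tlay (clabs X)).1 ->
    ev r' (Bin Add (Bin Mul (Reg 10) (lookup 14 (Reg 5))) (bits (lookup 14 (Reg 5)))) = sp.
  move=> h h' h''; apply: eval_add; [apply: eval_mul => //|apply: ev_bits => //|].
  - exact: f14.
  - by apply: leq_ltn_trans yx _; apply: leq_ltn_trans Bd_poly; lia.
  - exact: f14.
  - by apply: leq_ltn_trans (leq_add yx rdB) _; apply: leq_ltn_trans Bd_poly; lia.
rewrite /choice_block (block_run_cons _ _ s1) (block_run_cons _ _ (s2 _ _ _)) //.
rewrite (block_run_cons _ _ (s3 _ _ _)) // (block_run_cons _ _ (f11 _ _)) //.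
rewrite (block_run_cons _ _ (s5 _ _ _)) // (block_run_cons _ _ (s6 _ _ _)) //.
rewrite (block_run_cons _ _ (s7 _ _ _ _)) //; split=> //.
by apply: leq_add.
Qed.

Lemma source_run (r : regs) (x : source) a sp O fm ff k :
  source_fits O (4 * Th * U) x -> O <= Bd -> a <= Bd -> sp <= Bd * Bd + Bd ->
  fm < 32 -> ff < 32 -> k < table_len ->
  entries fm k = smod x -> entries ff k = sflag x ->
  r 4 = a + soff x -> r 6 = sp -> r 9 = k ->
  ev r (Bin Add (bits (lookup fm (Reg 9))) (Bin Mul (Reg 6) (lookup ff (Reg 9)))) =
    source_value n a sp x /\
  source_value n a sp x <= Bd * Bd + 2 * Bd.
Proof.
move=> [h1 h2 h3 [M hM]] OB aB spB hfm hff hk em ef r4 r6 r9.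
have [Bd1 Bd2] := Bd_lt.
have mB : smod x <= Bd by apply: leq_trans h2 H_Bd.
have rdB : readbits n (a + soff x) (smod x) <= Bd.
  by apply: leq_trans (ltnW (ltn_pmod _ _)) mB; rewrite hM expn_gt0.
have spf : sp * sflag x <= Bd * Bd + Bd.
  by apply: leq_trans spB; rewrite -[X in _ <= X]muln1 leq_mul2l h3 orbT.
have bnd : source_value n a sp x <= Bd * Bd + 2 * Bd.
  apply: leq_trans (leq_add rdB spf) _; lia.
split=> //; apply: eval_add.
- rewrite hM; apply: ev_bits => //; [by lia| |by rewrite -hM].
  by rewrite (ev_lookup (k := k)) ?em.
- apply: eval_mul => //.
    by rewrite (ev_lookup (k := k)) ?ef //; apply: leq_trans h3 _; lia.
  by apply: leq_ltn_trans spf _; apply: leq_ltn_trans Bd_poly; lia.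
by apply: leq_ltn_trans bnd _; apply: leq_ltn_trans Bd_poly; lia.
Qed.

Lemma descend_run (r : regs) Om X a sp (i : 'I_B) :
  inner (lab X) -> a + (lay (lab X)).1 <= Om -> Om <= 2 ^ t -> sp <= Bd * Bd + Bd ->
  r 2 = a -> r 6 = sp -> r 7 = pack (clabs X) -> r 8 = i ->
  let r' := block_run W Tb D r descend_block in
  [/\ r' 0 = label_code (lab (child X i)),
      r' 1 = link_value n a sp (clink (clabs X) i),
      r' 2 = a + loff (clink (clabs X) i) &
      r' 3 = inner (lab (child X i))].
Proof.
move=> hi haO hOm spB r2 r6 r7 r8.
have [Bd1 Bd2] := Bd_lt.
have [lf loffM] := child_link_fits i hi; set lk := clink (clabs X) i in lf loffM *.
have vB := small_le_Bd (leq_trans (tuple_mem_le hi) (lay_mem_le X)).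
have aB : a <= Bd.
  by apply: small_le_Bd; apply: leq_trans (leq_trans (leq_addr _ _) haO) hOm.
have [[lf1 lf2 lf3 lf4 /andP [lf5 lf5']] lf6 lf7] := lf.
have toB m : m <= 4 * Th * U -> m <= Bd by move=> h; apply: leq_trans h H_Bd.
pose k := pack (clabs X) * B + i.
have kV : k < nl ^ B * B.
  apply: leq_trans (_ : (pack (clabs X)).+1 * B <= _).
    by rewrite /k mulSn addnC ltn_add2r.
  by rewrite leq_mul2r pack_lt orbT.
have hk : k < table_len by rewrite /table_len mulnDr; lia.
have kB : 32 * k < Bd by apply: leq_trans Len_Bd; rewrite ltn_mul2l.
have h3 r' : ev r' (header 3) = B by apply: ev_header => //; apply: small_le_Bd.
have fl fld F (r' : regs) : fld < 32 -> entries fld k = F -> F <= Bd -> r' 9 = k ->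
    ev r' (lookup fld (Reg 9)) = F.
  by move=> h1 h2 h4 h5; rewrite (ev_lookup (k := k)) ?h2.
have le fld F : entries fld k = link_entry F k -> entries fld k = F lk.
  by move=> ->; rewrite link_entryE.
have s1 : ev r (Bin Add (Bin Mul (Reg 7) (header 3)) (Reg 8)) = k.
  apply: eval_add; [|exact: r8|by rewrite -/k; lia].
  apply: eval_mul => //; apply: leq_ltn_trans (leq_addr i _) _; rewrite -/k; lia.
have [o1 o2] : soff (glow (lgroup lk)) <= Bd /\ soff (ghigh (lgroup lk)) <= Bd.
  by case: lf1 lf2 => [h _ _ _] [h' _ _ _]; split; apply: leq_trans vB.
have s2 (r' : regs) : r' 2 = a -> r' 9 = k ->
    ev r' (Bin Add (Reg 2) (lookup 16 (Reg 9))) = a + soff (glow (lgroup lk)).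
  by move=> h h'; apply: eval_add; [|apply: (fl 16 _ _ isT (le 16 _ erefl))|lia].
have s4 (r' : regs) : r' 2 = a -> r' 9 = k ->
    ev r' (Bin Add (Reg 2) (lookup 21 (Reg 9))) = a + soff (ghigh (lgroup lk)).
  by move=> h h'; apply: eval_add; [|apply: (fl 21 _ _ isT (le 21 _ erefl))|lia].
have src1 (r' : regs) := source_run (r := r') (fm := 17) (ff := 18) (k := k)
  lf1 vB aB spB isT isT hk (le 17 _ erefl) (le 18 _ erefl).
have src2 (r' : regs) := source_run (r := r') (fm := 22) (ff := 23) (k := k)
  lf2 vB aB spB isT isT hk (le 22 _ erefl) (le 23 _ erefl).
pose v1 := source_value n a sp (glow (lgroup lk)) %/ gdiv (lgroup lk).
pose v2 := source_value n a sp (ghigh (lgroup lk)) %% gmod (lgroup lk).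
have s3 (r' : regs) : r' 4 = a + soff (glow (lgroup lk)) -> r' 6 = sp -> r' 9 = k ->
    ev r' (Bin Div (Bin Add (bits (lookup 17 (Reg 9)))
             (Bin Mul (Reg 6) (lookup 18 (Reg 9)))) (lookup 19 (Reg 9))) = v1.
  move=> a1 a2 a3; have [e1 _] := src1 r' a1 a2 a3.
  by apply: eval_div; [exact: e1|apply: (fl 19 _ _ isT (le 19 _ erefl)) => //; apply: toB].
have v1B : v1 <= Bd * Bd + 2 * Bd.
  have [_ h] := src1 (upd (upd (upd r 9 k) 6 sp) 4 (a + soff (glow (lgroup lk))))
    erefl erefl erefl.
  by apply: leq_trans (leq_div _ _) h.
have s5 (r' : regs) : r' 4 = a + soff (ghigh (lgroup lk)) -> r' 6 = sp -> r' 9 = k ->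
    ev r' (Bin Mod (Bin Add (bits (lookup 22 (Reg 9)))
             (Bin Mul (Reg 6) (lookup 23 (Reg 9)))) (lookup 24 (Reg 9))) = v2.
  move=> a1 a2 a3; have [e1 _] := src2 r' a1 a2 a3.
  by apply: eval_mod; [exact: e1|apply: (fl 24 _ _ isT (le 24 _ erefl)) => //; apply: toB].
have v2B : v2 <= Bd by apply: leq_trans (ltnW (ltn_pmod _ lf5)) (toB _ lf5').
have dB : gmul (lgroup lk) * v2 <= Bd * Bd by apply: leq_mul => //; apply: toB.
have s6 (r' : regs) : r' 10 = v1 -> r' 11 = v2 -> r' 9 = k ->
    ev r' (Bin Mod (Bin Div (Bin Add (Reg 10) (Bin Mul (lookup 20 (Reg 9)) (Reg 11)))
                           (lookup 25 (Reg 9))) (lookup 26 (Reg 9))) =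
    link_value n a sp lk.
  move=> a1 a2 a3; apply: eval_mod; last first.
    by apply: (fl 26 _ _ isT (le 26 _ erefl)) => //; apply: toB.
  apply: eval_div; last by apply: (fl 25 _ _ isT (le 25 _ erefl)) => //; apply: toB.
  apply: eval_add => //.
    apply: eval_mul => //; first by apply: (fl 20 _ _ isT (le 20 _ erefl)) => //; apply: toB.
    by apply: leq_ltn_trans dB _; apply: leq_ltn_trans Bd_poly; lia.
  apply: leq_ltn_trans (leq_add v1B dB) _; apply: leq_ltn_trans Bd_poly; lia.
have s7 (r' : regs) : r' 2 = a -> r' 9 = k ->
    ev r' (Bin Add (Reg 2) (lookup 27 (Reg 9))) = a + loff lk.
  have lB := leq_trans loffM vB.
  by move=> h h'; apply: eval_add; [|apply: (fl 27 _ _ isT (le 27 _ erefl))|lia].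
have lt := label_code_lt (lab (child X i)).
have s8 (r' : regs) : r' 9 = k -> ev r' (lookup 28 (Reg 9)) = label_code (lab (child X i)).
  apply: fl => //; first by rewrite child_entryE tnth_mktuple.
  by apply: small_le_Bd; apply: leq_trans (ltnW lt) nl_le.
have s9 (r' : regs) : r' 0 = label_code (lab (child X i)) ->
    ev r' (lookup 4 (Reg 0)) = inner (lab (child X i)).
  move=> hr; rewrite (ev_lookup (k := label_code (lab (child X i)))) //= ?label_entryE //.
  by apply: leq_trans (leq_b1 _) _; lia.
rewrite /descend_block (block_run_cons _ _ s1) (block_run_cons _ _ (s2 _ _ _)) //.
rewrite (block_run_cons _ _ (s3 _ _ _ _)) // (block_run_cons _ _ (s4 _ _ _)) //.
rewrite (block_run_cons _ _ (s5 _ _ _ _)) // (block_run_cons _ _ (s6 _ _ _ _)) //.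
rewrite (block_run_cons _ _ (s7 _ _ _)) // (block_run_cons _ _ (s8 _ _)) //.
by rewrite (block_run_cons _ _ (s9 _ _)).
Qed.

Lemma leaf_run (r : regs) X : ~~ inner (lab X) ->
  r 0 = label_code (lab X) -> r 1 = leafspill X ->
  reports_leaf sz (block_run W Tb D r leaf_block) (leafobj X).
Proof.
move=> hi r0 r1; have [Bd1 Bd2] := Bd_lt.
have hl fld F : fld < 32 -> entries fld (label_code (lab X)) = F -> F <= Bd ->
    ev r (lookup fld (Reg 0)) = F.
  by move=> h1 h2 h3; rewrite (ev_lookup (k := label_code (lab X))) ?h2.
have h8 : ev r (lookup 8 (Reg 0)) = (sz X == 1).
  apply: hl => //; first by rewrite /= label_entryE phisizeE.
  by apply: leq_trans (leq_b1 _) _; lia.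
have posL : leafpos X < table_len /\ leafpos X <= Bd.
  have [s1|s1] := eqVneq (sz X) 1.
    have [h _] := leafentryE s1; split; first by rewrite /table_len; lia.
    by apply: small_le_Bd; apply: leq_trans (ltnW h) size1_le.
  by rewrite /leafpos /leafbase /leafspill phisizeE (negPf s1).
have baseB : leafbase (lab X) <= Bd by apply: leq_trans (leq_addr _ _) posL.2.
have h9 : ev r (lookup 9 (Reg 0)) = leafbase (lab X).
  by apply: hl => //; rewrite /= label_entryE.
have hp : ev r (Bin Add (lookup 9 (Reg 0)) (Reg 1)) = leafpos X.
  by apply: eval_add => //; rewrite -/(leafpos X); lia.
have eB : leafentry (leafpos X) <= Bd.
  by apply: small_le_Bd; apply: leq_trans (leafentry_le _) size1_le.
have h29 : ev r (lookup 29 (Bin Add (lookup 9 (Reg 0)) (Reg 1))) = leafentry (leafpos X).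
  by rewrite (ev_lookup (k := leafpos X)) //; case: posL.
have hm : ev r (Bin Mul (lookup 8 (Reg 0))
    (lookup 29 (Bin Add (lookup 9 (Reg 0)) (Reg 1)))) = (sz X == 1) * leafentry (leafpos X).
  apply: eval_mul => //; apply: leq_ltn_trans (_ : Bd < _); last by lia.
  by apply: leq_trans eB; rewrite -[X in _ <= X]mul1n leq_mul2r leq_b1 orbT.
rewrite /leaf_block (block_run_cons _ _ hm); split=> //=.
rewrite /upd /=; have [s1|s1] := eqVneq (sz X) 1 => //.
by rewrite mul1n; have [_ ->] := leafentryE s1.
Qed.

(** [Pd] stands for a bound on the number of rounds. It only has to admit 0 at leaves and to grow by
    one per level, which leaves the real-valued estimate of the depth to the final proof. *)
Lemma loop_exec (Pd : A -> nat -> Prop) Om a x X :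
  (forall Y, ~~ inner (lab Y) -> Pd Y 0) ->
  (forall Y i d, inner (lab Y) -> Pd (child Y i) d -> Pd Y d.+1) ->
  Om <= 2 ^ t -> enc Om n a x X ->
  forall (r : regs) s, r 0 = label_code (lab X) -> r 1 = x -> r 2 = a ->
    r 3 = inner (lab X) ->
  exists d r' s' Y,
    [/\ exec W Tb D ask (While 3 step_code) r s (d * step_cost.+1).+1 r' s',
        ~~ inner (lab Y), r' 0 = label_code (lab Y) /\ r' 1 = leafspill Y,
        query_abtree q (tree X) s = answer q s' (leafobj Y) & Pd X d].
Proof.
move=> Pd0 PdS hOm; elim=> {a x X} [a x X hi hx ex ha|a x X y sp hi hx ha hsel hsp henc IH].
  move=> r s r0 r1 r2 r3; exists 0, r, s, X; split=> //.
  - by apply: ExWhileStop; rewrite r3 (negPf hi).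
  - by rewrite -ex.
  - by rewrite abtree_leaf.
  - exact: Pd0.
move=> r s r0 r1 r2 r3.
have [spB c2 c6 c7] := choice_run hi hx ha hOm hsel r0 r1 r2.
have [ra xa ha'] := block_exec W Tb D ask s (isT : block_vars choice_block)
  (fun k _ => erefl (r k)).
set lv := [tuple root_label ([ffun i => tree (child X i)] i) | i < B].
have elv : lv = clabs X.
  by apply: eq_from_tnth => i; rewrite !tnth_mktuple ffunE root_label_tree.
pose ch := Defs.choose q s lv; pose i := ch.1; pose s1 := ch.2.
have xb : exec W Tb D ask (Choose 8 7) ra s 1 (upd ra 8 i) s1.
  by apply: ExChoose; exists lv; split=> //; rewrite ha' // c7 elv.
have spE : sp = tspill n a (lab X) (clabs X) y by [].
rewrite -spE in spB c6.
have [d0 d1 d2 d3] := descend_run (r := upd ra 8 i) (i := i) hi ha hOm spB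
  (etrans (ha' 2 isT) c2) (etrans (ha' 6 isT) c6) (etrans (ha' 7 isT) c7) erefl.
have [rc xc hc] := block_exec W Tb D ask s1 (isT : block_vars descend_block)
  (fun k _ => erefl (upd ra 8 i k)).
have [d [r' [s' [Y [xl hY hr hq hd]]]]] := IH i rc s1
  (etrans (hc 0 isT) d0) (etrans (hc 1 isT) d1) (etrans (hc 2 isT) d2)
  (etrans (hc 3 isT) d3).
exists d.+1, r', s', Y; split=> //.
- have -> : d.+1 * step_cost.+1 = step_cost + (d * step_cost.+1).+1.
    by rewrite mulSn addSnnS.
  by apply: (ExWhileLoop _ (ExSeq xa (ExSeq xb xc)) xl); rewrite r3 hi.
- by rewrite abtree_inner //= -hq ffunE.
- exact: PdS hd.
Qed.

Lemma query_exec (Pd : A -> nat -> Prop) X s0 :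
  (forall Y, ~~ inner (lab Y) -> Pd Y 0) ->
  (forall Y i d, inner (lab Y) -> Pd (child Y i) d -> Pd Y d.+1) ->
  enc (lay (lab X)).1 n 0 (readbits n (lay (lab X)).1 (2 ^ spill_bits (lab X))) X ->
  exists2 d, Pd X d &
    returns sz q W Tb D query_code (f X) (gval decompose X) s0
      (block_cost init_block + ((d * step_cost.+1).+1 + block_cost leaf_block))
      (query_abtree q (tree X) s0).
Proof.
move=> Pd0 PdS henc.
have [ra xa ha] := block_exec W Tb D ask s0 (isT : block_vars init_block)
  (fun k _ => erefl (init_regs (f X) (gval decompose X) k)).
rewrite init_run in ha.
have [d [r' [s' [Y [xl hY [h0 h1] hq hd]]]]] := loop_exec Pd0 PdS (lay_mem_le X) henc s0
  (ha 0 isT) (ha 1 isT) (ha 2 isT) (ha 3 isT).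
have [rb xb hb] := block_exec W Tb D ask s' (isT : block_vars leaf_block)
  (fun k _ => erefl (r' k)).
exists d => //; exists rb, s', (leafobj Y); split=> //.
  exact: ExSeq xa (ExSeq xl xb).
have [g0 g1] := leaf_run hY h0 h1.
by split; rewrite hb.
Qed.

End Data.

(** * Uniqueness of decoding *)

Lemma leafspill_inj X Y : lab X = lab Y -> sz X = 1 -> leafspill X = leafspill Y -> X = Y.
Proof.
move=> e s1 es; have s1' : sz Y = 1 by rewrite -s1; apply: f_sz; case: e.
have [_ eX] := leafentryE s1; have [_ eY] := leafentryE s1'.
move: eX; rewrite /leafpos e es -/(leafpos Y) eY => -[] h.
have hX : X \in enum (size1 sz) by rewrite mem_enum inE s1.
have hY : Y \in enum (size1 sz) by rewrite mem_enum inE s1'.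
by rewrite -(nth_index X hX) -h nth_index.
Qed.

Lemma encodes_leafE O n a x X : enc O n a x X -> ~~ inner (lab X) -> x = leafspill X.
Proof. by case=> // {}a {}x {}X y s ->. Qed.

Lemma encodes_innerE O n a x X : enc O n a x X -> inner (lab X) -> exists y,
  choose_child (lab X) x = (clabs X, y) /\
  forall i : 'I_B, enc O n (a + loff (clink (clabs X) i))
    (link_value n a (tspill n a (lab X) (clabs X) y) (clink (clabs X) i)) (child X i).
Proof.
case=> [{}a {}x {}X /negPf -> //|{}a {}x {}X y s _ _ _ h1 h2 h3 _].
by exists y; rewrite -h2.
Qed.

(** Equal labels, data and spills select the same tuple of child labels and the same merged spill,
    so the decoding coincides all the way down. Only the trees agree, since objects of size 0 may
    share a code. *)
Lemma encodes_tree O O' n a x X Y : enc O n a x X -> enc O' n a x Y -> lab X = lab Y ->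
  tree X = tree Y.
Proof.
move=> h; elim: h Y => {a x X} [a x X hi hx ex ha|a x X y sp hi hx ha hsel hsp henc IH] Y.
  move=> hY e; have hiY : ~~ inner (lab Y) by rewrite -e.
  have es := encodes_leafE hY hiY.
  have eszXY : sz X = sz Y by apply: f_sz; case: e.
  rewrite !abtree_leaf // /leafobj e -eszXY; case: eqP => // s1.
  by rewrite (leafspill_inj e s1 _) // -ex.
move=> hY e; have hiY : inner (lab Y) by rewrite -e.
have [y' [hsel' henc']] := encodes_innerE hY hiY.
rewrite -e hsel in hsel'.
have ev : clabs X = clabs Y := congr1 fst hsel'.
have ey : y = y' := congr1 snd hsel'.
rewrite -ey -e in henc'.
rewrite !abtree_inner // e; congr Node; apply/ffunP => i; rewrite !ffunE.
apply: IH; first by rewrite hsp ev; exact: henc'.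
by have := congr1 (fun v => tnth v i) ev; rewrite !tnth_mktuple.
Qed.

Definition stores (n : nat) (X : A) : Prop :=
  n < 2 ^ store_bits X /\
  enc (lay (lab X)).1 n 0 (readbits n (lay (lab X)).1 (2 ^ spill_bits (lab X))) X.

Lemma stores_exists X : exists n, stores n X.
Proof.
have [mem [x [hm hx he]]] : exists mem x,
  [/\ mem < 2 ^ (lay (lab X)).1, x < (lay (lab X)).2 &
      forall O D a, readbits D a (2 ^ (lay (lab X)).1) = mem ->
        a + (lay (lab X)).1 <= O -> enc O D a x X].
  apply: (encodes_exists (E := E)) => //.
  - exact: rk_part.
  - by move=> Y _; apply: leafspill_lt.
  - exact: labcard_part.
have hx' : x < 2 ^ spill_bits (lab X) by apply: leq_trans hx _; apply: up_logP.
exists (mem + 2 ^ (lay (lab X)).1 * x); split; first exact: cat_lt.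
by rewrite readbits_high //; apply: he => //; rewrite readbits_low.
Qed.

Lemma stores_tree n n' X Y : stores n X -> stores n' Y -> lab X = lab Y ->
  bits_of n (store_bits X) = bits_of n' (store_bits Y) -> tree X = tree Y.
Proof.
move=> [lt h] [lt' h'] e eb.
(* Taking the whole string as a single word reads the number back from its bits. *)
have hd m Z : m < 2 ^ store_bits Z ->
    data_word (store_bits Z) (bits_of m (store_bits Z)) 0 = m.
  by move=> hm; rewrite data_word_bits_of // /readbits divn1 modn_small.
have eS : store_bits X = store_bits Y by rewrite /store_bits e.
have en : n = n' by rewrite -(hd n X lt) -(hd n' Y lt') eb eS.
by rewrite -en -e in h'; apply: encodes_tree h h' e.
Qed.

End Run.

(** * Logarithmic estimates *)

Import Order.TTheory GRing.Theory Num.Theory.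

Section Logs.
Context (R : realType).
Local Open Scope ring_scope.

Lemma ln2_gt0 : 0 < ln (2 : R).
Proof. by rewrite ln_gt0 // ltr1n. Qed.

Lemma ln_natX (m k : nat) : (0 < m)%N -> ln ((m ^ k)%N%:R : R) = k%:R * ln (m%:R : R).
Proof. by move=> m0; rewrite natrX lnXn ?ltr0n // mulr_natl. Qed.

Lemma ler_ln_nat (m k : nat) : (0 < m)%N -> (0 < k)%N ->
  (ln (m%:R : R) <= ln (k%:R : R)) = (m <= k)%N.
Proof. by move=> m0 k0; rewrite ler_ln ?posrE ?ltr0n // ler_nat. Qed.

Lemma ln_nat_ge0 (m : nat) : 0 <= ln (m%:R : R).
Proof.
case: m => [|m]; first by rewrite ln0.
by apply: ln_ge0; rewrite ler1n.
Qed.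

Lemma log2_le_nat (m k : nat) : (0 < m)%N -> log2 (m%:R : R) <= k%:R -> (m <= 2 ^ k)%N.
Proof.
move=> m0; rewrite /log2 ler_pdivrMr ?ln2_gt0 // -[2]/(2%:R) -ln_natX //.
by rewrite ler_ln_nat // expn_gt0.
Qed.

Lemma log2_ge_nat (m k j : nat) : (0 < m)%N -> (2 ^ k <= 2 ^ j * m)%N ->
  (k%:R : R) <= log2 (m%:R) + j%:R.
Proof.
move=> m0; rewrite -(ler_ln_nat (expn_gt0 2 k : (0 < 2 ^ k)%N)); last first.
  by rewrite muln_gt0 expn_gt0.
rewrite natrM lnM ?posrE ?ltr0n ?expn_gt0 // !ln_natX // => h.
rewrite /log2 -(ler_pM2r ln2_gt0) mulrDl divfK ?lt0r_neq0 ?ln2_gt0 //.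
by rewrite addrC.
Qed.

(** Here the hypothesis on [B] enters: it makes the number of tuples of labels polynomial in
    [2^w]. *)
Lemma word_bound (c : R) (c0 B w s : nat) : c <= c0%:R -> (1 < s)%N ->
  B%:R <= c * (w%:R / log2 s%:R) -> (s ^ B <= 2 ^ (c0 * w))%N.
Proof.
move=> hc s1; have lns : 0 < ln (s%:R : R) by rewrite ln_gt0 // ltr1n.
have l2 := ln2_gt0.
rewrite /log2 invf_div !mulrA ler_pdivlMr // => h.
rewrite -ler_ln_nat ?expn_gt0 // ?(ltnW s1) // !ln_natX // ?(ltnW s1) //.
apply: le_trans h _; rewrite natrM ler_pM2r //.
by rewrite ler_wpM2r.
Qed.

Lemma half_bound (delta : R) (B m k : nat) : (0 < B)%N -> delta <= B%:R / 2 ->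
  m%:R <= delta * k%:R / B%:R -> (2 * m <= k)%N.
Proof.
move=> B0 hd; rewrite ler_pdivlMr ?ltr0n // => h.
have B0' : 0 < B%:R :> R by rewrite ltr0n.
have k0 : 0 <= k%:R :> R by [].
rewrite -(ler_nat R) natrM -(ler_pM2r B0').
have h2 : delta * k%:R <= B%:R / 2 * k%:R by rewrite ler_wpM2r.
have := le_trans h h2; lra.
Qed.

(** The depth is about the logarithm of the size to base [B / delta], to be compared with base [B]
    by a factor independent of [B]. With [g = ln B - ln delta >= ln 2] and [delta > 1], [ln B = g +
    ln delta <= (1 + ln delta / ln 2) * g]; for [delta <= 1] already [ln B <= g]. The factor 2 is
    slack. *)
Definition depth_rate (delta : R) : nat :=
  Num.bound (2 + 2 * ln (Num.max delta 1) / ln 2).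

Lemma depth_rateP (delta : R) (B : nat) : (1 < B)%N -> 0 < delta -> delta <= B%:R / 2 ->
  ln B%:R <= (depth_rate delta)%:R * (ln B%:R - ln delta).
Proof.
move=> B1 d0 dB; have l2 := ln2_gt0.
have lB : 0 < ln (B%:R : R) by rewrite ln_gt0 // ltr1n.
set b := ln (Num.max delta 1); have b0 : 0 <= b.
  by rewrite /b ln_ge0 // le_max lexx orbT.
have q0 : 0 <= 2 * b / ln 2 by rewrite divr_ge0 ?mulr_ge0 // ltW.
have k2 : 2 + 2 * b / ln 2 < (depth_rate delta)%:R.
  by rewrite /depth_rate; apply: archi_boundP; lra.
have db : ln delta <= b by rewrite /b ler_ln ?posrE ?lt_max ?d0 // le_max lexx.
have gap : ln delta + ln 2 <= ln (B%:R : R).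
  rewrite -lnM ?posrE // ler_ln ?posrE ?mulr_gt0 // ?ltr0n ?(ltnW B1) //; lra.
set k := (depth_rate delta)%:R in k2 *; set g := ln B%:R - ln delta.
have g0 : ln 2 <= g by rewrite /g; lra.
have g0' : 0 < g by lra.
have [d1|d1] := leP delta 1.
  have : ln delta <= 0 by rewrite ln_le0.
  move=> ld; have : ln B%:R <= g by rewrite /g; lra.
  have : 1 * g <= k * g by apply: ler_wpM2r; lra.
  by lra.
have eb : b = ln delta by rewrite /b max_l // ltW.
have h1 : (2 + 2 * b / ln 2) * g <= k * g by apply: ler_wpM2r; lra.
have h2 : 2 * b <= 2 * b / ln 2 * g.
  by rewrite mulrAC ler_pdivlMr // ler_wpM2l //; lra.
have hB : ln B%:R = g + b by rewrite eb /g subrK.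
apply: le_trans h1; rewrite mulrDl hB; move: h2 g0' b0.
by move: (2 * b / ln 2 * g) => z; clear; lra.
Qed.

End Logs.

Theorem theorem2 (R : realType) (c delta : R) :
  exists (kappa C : nat) (P : cmd),
  forall (w B : nat) (A Phi Phi2 : finType) (sz : A -> nat) (f : A -> Phi)
    (decompose : A -> Phi2 * B.-tuple A) (join : Phi2 * B.-tuple A -> A)
    (f' : Phi2 * B.-tuple Phi -> Phi),
  0 < B ->
  (forall X Y : A, f X = f Y -> sz X = sz Y) ->
  (forall X : A, join (decompose X) = X) ->
  (forall (be : Phi2) (Xs : B.-tuple A),
     calF f decompose (be, map_tuple f Xs) ->
     decompose (join (be, Xs)) = (be, Xs)) ->
  (forall X : A, f X = f' (profile f decompose X)) ->
  (delta <= B%:R / 2)%R ->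
  (forall (X : A) (i : 'I_B),
     ((sz (part decompose X i))%:R <= delta * (sz X)%:R / B%:R)%R) ->
  (B%:R <= c * (w%:R / log2 (#|Phi| + #|Phi2|)%:R))%R ->
  #|size1 sz| <= 2 ^ w ->
  (forall (al : Phi) (be : Phi2),
     (log2 (numN f decompose al be)%:R <= (2 ^ w)%:R :> R)%R) ->
  exists (T : seq nat) (store : A -> bitseq)
    (load : Phi -> Phi2 -> bitseq -> abtree A Phi Phi2 B),
  [/\ size T <= C * (#|size1 sz| +
        #|Phi| ^ B * #|Phi2| ^ B * (#|Phi| * #|Phi2| + B)),
      all (fun x => x < 2 ^ (kappa * w)) T &
      forall X : A,
      [/\ ((size (store X))%:R <=
             log2 (numN f decompose (f X) (gval decompose X))%:R + 2 :> R)%R,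
          load (f X) (gval decompose X) (store X) =
            abtree_of sz f decompose X &
          forall (S Ans : Type) (q : query A Phi Phi2 B S Ans) (s0 : S),
          exists t : nat,
            returns sz q (kappa * w) T (store X) P (f X) (gval decompose X)
              s0 t (query_abtree q (abtree_of sz f decompose X) s0) /\
            (1 < B ->
             (t%:R <= C%:R * (1 + ln (sz X)%:R / ln B%:R) :> R)%R)]].
Proof.
have [c0 c0P] : exists c0 : nat, (c <= c0%:R)%R.
  exists (Num.bound `|c|%R).
  by apply: le_trans (ler_norm c) (ltW (archi_boundP (normr_ge0 c))).
(* The tuples of labels number at most [s^(2B) <= 2^(2 c0 w)]; the further [4 w] absorbs the factor
   [6 * 2^w] of [#|Phi|] and gives [t >= 4]. *)
pose tau := 2 * c0 + 4.
pose kd := depth_rate delta.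
pose k0 := block_cost init_block + block_cost leaf_block + 1.
(* 160 is the stride 32 of the tables times 5, from [4 Y + 1 <= 5 Y]; the other summands are the
   cost outside the loop and the cost of the rounds. *)
exists (20 * tau), (160 + (k0 + step_cost.+1 * (1 + kd))), query_code.
move=> w B A Phi Phi2 sz f decompose join f' B0 f_sz _ decK f'P dB szd hB s1w hN.
(* Without objects the label types may be empty; then an empty table does. *)
have [A0|/card_gt0P [X0 _]] := posnP #|A|.
  exists [::], (fun=> [::]), (fun al be _ => Leaf (al, be, None)); split=> // X.
  by have := card0_eq A0 X; rewrite inE.
have Phi0 : 0 < #|Phi| by apply/card_gt0P; exists (f X0).
have Phi20 : 0 < #|Phi2| by apply/card_gt0P; exists (gval decompose X0).
set s := #|Phi| + #|Phi2| in hB.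
have s1 : 1 < s by rewrite /s; lia.
have sB : s ^ B <= 2 ^ (c0 * w) := word_bound c0P s1 hB.
(* For [w = 0] one would get [s^B <= 1], although [s >= 2]. *)
have w0 : 0 < w.
  rewrite lt0n; apply/eqP => w0; move: sB; rewrite w0 muln0 expn0.
  by rewrite leqNgt -{1}(exp1n B) ltn_exp2r // s1.
pose t := tau * w.
have eW : 20 * tau * w = 20 * t by rewrite mulnA.
have t_ge k : k <= c0 * w -> 2 * k + 4 * w <= t by rewrite /t /tau; nia.
have pow_le k m : m <= 2 ^ k -> k <= t -> m <= 2 ^ t.
  by move=> h1 h2; apply: leq_trans h1 _; rewrite leq_exp2l.
have t_big : 2 * (c0 * w) + 4 * w <= t := t_ge _ (leqnn _).
have s_le : s <= s ^ B by rewrite -{1}(expn1 s) leq_exp2l.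
have hV : (#|Phi| * #|Phi2|) ^ B <= 2 ^ t.
  apply: (pow_le (c0 * w + c0 * w)); last by lia.
  rewrite expnD; apply: leq_trans (leq_mul sB sB); rewrite -expnMn.
  by rewrite leq_exp2r //; apply: leq_mul; rewrite /s; lia.
have hnl : #|Phi| * #|Phi2| <= 2 ^ t.
  by apply: leq_trans hV; rewrite -{1}(expn1 (_ * _)) leq_pexp2l // muln_gt0 Phi0.
have hBt : B <= 2 ^ t.
  apply: (pow_le (c0 * w)); last by lia.
  by apply: leq_trans sB; apply: ltnW; apply: ltn_expl.
have hPhi : 6 * #|Phi| * 2 ^ w <= 2 ^ t.
  apply: (pow_le (3 + c0 * w + w)); last by lia.
  have hP : #|Phi| <= 2 ^ (c0 * w).
    by apply: leq_trans sB; apply: leq_trans s_le; apply: leq_addr.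
  by rewrite !expnD; apply: leq_mul => //; apply: leq_mul.
have hs1 : #|size1 sz| <= 2 ^ t by apply: (pow_le w) => //; lia.
have t4 : 3 < t by lia.
have eN X : numN f decompose (f X) (gval decompose X) =
    labcard (lab f decompose) (lab f decompose X).
  by apply: eq_card => Y; rewrite !inE.
have N0 X : 0 < numN f decompose (f X) (gval decompose X).
  by apply/card_gt0P; exists X; rewrite !inE !eqxx.
have hN2 X : labcard (lab f decompose) (lab f decompose X) <= 2 ^ (2 ^ w).
  by rewrite -eN; apply: (@log2_le_nat R).
have szp X i : 2 * sz (part decompose X i) <= sz X.
  exact: (half_bound B0 dB (szd X i)).
have [alias aliasP] := alias_family B0 f_sz decK f'P szp t4 hnl hBt hV hPhi hs1.
have [store hstore] := boolp.choice
  (stores_exists B0 f_sz decK f'P szp t4 hnl hBt hV hPhi hs1 aliasP).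
pose bitsX X := bits_of (store X) (store_bits t sz f decompose X).
exists (table (20 * t) (table_len B Phi Phi2 sz) (entries t sz f decompose alias)), bitsX.
(* Any object with this label and this string has the right tree, by [stores_tree]. *)
exists (fun al be D => if [pick X | (lab f decompose X == (al, be)) && (bitsX X == D)]
  is Some X then abtree_of sz f decompose X else Leaf (al, be, None)).
rewrite eW; split.
- rewrite size_mkseq /table_len expnMn.
  set Y := #|Phi| ^ B * #|Phi2| ^ B * (#|Phi| * #|Phi2| + B).
  have : 0 < Y by rewrite !muln_gt0 !expn_gt0 Phi0 Phi20 addn_gt0 B0 orbT.
  by set a1 := #|size1 sz|; nia.
- by apply/allP => x /mapP [k _ ->]; rewrite ltn_pmod // expn_gt0.
move=> X; split.
- rewrite size_mkseq; apply: log2_ge_nat; first exact: N0.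
  by rewrite eN; apply: (store_bits_le B0 f_sz decK f'P szp t4 hnl hBt hV hPhi hs1).
- case: pickP => [Y /andP [/eqP eY /eqP eb]|/(_ X)]; last by rewrite !eqxx.
  by apply: (stores_tree B0 f_sz szp t4 hnl hBt hV hPhi hs1 (hstore Y) (hstore X)).
move=> S Ans q s0.
(* [1 < B] is part of the predicate because [ln B = 0] for [B = 1]. *)
pose Pd (Y : A) (d : nat) := 1 < B ->
  (d%:R <= (if (1 < sz Y)%N then 1 + kd%:R * (ln (sz Y)%:R / ln B%:R) else 0) :> R)%R.
have inE' Y : inner sz f (lab f decompose Y) = (1 < sz Y) := innerE _ f_sz Y.
have [ltX encX] := hstore X.
have [|Y i d hi hd|d hd hret] := query_exec B0 f_sz decK f'P szp t4 hnl hBt hV hPhi hs1 hN2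
    aliasP q ltX (Pd := Pd) s0 _ _ encX.
- by move=> Y; rewrite inE' => /negPf h _; rewrite h.
- move=> B1; have {}hd := hd B1; rewrite inE' in hi; rewrite hi.
  have lB : (0 < ln (B%:R : R))%R by rewrite ln_gt0 // ltr1n.
  have lY : (0 <= kd%:R * (ln ((sz Y)%:R : R) / ln B%:R))%R.
    by rewrite mulr_ge0 // divr_ge0 ?ln_nat_ge0.
  (* Above a leaf only one round is left, covered by the summand 1. Otherwise a level lowers the
     logarithm of the size by at least [ln B - ln delta], and [kd] times this is at least [ln B]. *)
  case: ltnP hd => hc hd; last by rewrite -natr1; lra.
  suff : (1 + kd%:R * (ln ((sz (part decompose Y i))%:R : R) / ln B%:R) <=
          kd%:R * (ln ((sz Y)%:R : R) / ln B%:R))%R.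
    by rewrite -natr1; lra.
  have B0' : (0 < B%:R :> R)%R by rewrite ltr0n.
  have Y0 : (0 < (sz Y)%:R :> R)%R by rewrite ltr0n; lia.
  have C0 : (0 < (sz (part decompose Y i))%:R :> R)%R by rewrite ltr0n; lia.
  have hs := szd Y i; rewrite ler_pdivlMr // in hs.
  have d0 : (0 < delta)%R.
    have : (0 < delta * (sz Y)%:R)%R by apply: lt_le_trans hs; rewrite mulr_gt0.
    by rewrite pmulr_lgt0.
  have hk := depth_rateP B1 d0 dB.
  move: hs; rewrite -ler_ln ?posrE ?mulr_gt0 // !lnM ?posrE // => hs.
  rewrite !mulrA -(ler_pM2r lB) mulrDl mul1r !divfK ?lt0r_neq0 //.
  apply: le_trans (lerD hk (lexx _)) _; rewrite -mulrDr ler_wpM2l //.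
  by rewrite -/kd; lra.
exists (block_cost init_block + ((d * step_cost.+1).+1 + block_cost leaf_block)).
split=> // B1; have {}hd := hd B1.
have lB : (0 < ln (B%:R : R))%R by rewrite ln_gt0 // ltr1n.
set x := (ln (sz X)%:R / ln B%:R)%R.
have x0 : (0 <= x)%R by rewrite divr_ge0 ?ln_nat_ge0 // ltW.
have {}hd : (d%:R <= 1 + kd%:R * x)%R.
  apply: le_trans hd _; case: ifP => // _; rewrite addr_ge0 // mulr_ge0 //.
have -> : block_cost init_block + ((d * step_cost.+1).+1 + block_cost leaf_block) =
    k0 + step_cost.+1 * d by rewrite /k0 mulnC; lia.
move: (step_cost.+1) => sc; move: k0 => k1.
have h : (sc%:R * d%:R <= sc%:R * (1 + kd%:R * x) :> R)%R by apply: ler_wpM2l.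
rewrite !natrD !natrM natrD.
have p1 : (0 <= k1%:R * x)%R by rewrite mulr_ge0.
have p2 : (0 <= sc%:R * x)%R by rewrite mulr_ge0.
have p3 : (0 <= sc%:R * kd%:R :> R)%R by rewrite mulr_ge0.
have -> : ((160%:R + (k1%:R + sc%:R * (1%:R + kd%:R))) * (1 + x) =
  k1%:R + sc%:R * (1 + kd%:R * x) + (160 + 160 * x + k1%:R * x + sc%:R * x +
  sc%:R * kd%:R) :> R)%R by ring.
by lra.
Qed.
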